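(* Let $\mathbf{x} : M \to \mathbb{E}^N$ be an immersed $n$-dimensional submanifold of Euclidean space with the induced metric. Suppose that the immersion is proper (the preimage of every compact subset of $\mathbb{E}^N$ is compact in $M$) and that $M$ is nonnegative biminimal, i.e. for some real constant $\lambda \ge 0$ the mean curvature vector $\mathbf{H}$ satisfies $$\Delta^{\perp}\mathbf{H} - \sum_{i=1}^n h(A_{\mathbf{H}}e_i, e_i) = \lambda\,\mathbf{H} \quad \text{on } M.$$ Then $M$ is minimal, i.e. $\mathbf{H} = 0$ on $M$.
   Context: $M$ is a smooth $n$-dimensional manifold (without boundary), $\mathbf{x}: M\to\mathbb{E}^N$ is a smooth immersion into Euclidean space $\mathbb{E}^N=(\mathbb{R}^N,\langle\ ,\ \rangle)$, and $g$ is the induced metric. $\nabla$ and $D$ are the Levi-Civita connections of $(M,g)$ and $\mathbb{E}^N$. The second fundamental form $h$ is defined by $D_XY=\nabla_XY+h(X,Y)$ for tangent fields $X,Y$. For a normal field $\xi$, the Weingarten map $A_\xi$ and the normal connection $\nabla^\perp$ are defined by $D_X\xi=-A_\xi X+\nabla^\perp_X\xi$; one has $\langle h(X,Y),\xi\rangle=\langle A_\xi X,Y\rangle$. The mean curvature vector is $\mathbf{H}=\frac1n\sum_{i=1}^n h(e_i,e_i)$, where $\{e_i\}_{i=1}^n$ is a local orthonormal frame of $TM$. The normal Laplacian is the non-positive operator $\Delta^\perp=\sum_{i=1}^n\left(\nabla^\perp_{e_i}\nabla^\perp_{e_i}-\nabla^\perp_{\nabla_{e_i}e_i}\right)$ associated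 with $\nabla^\perp$. A submanifold is called biminimal (for a constant $\lambda\in\mathbb{R}$) if the immersion is a critical point of $E_{2}+\lambda E$ (bi-energy plus $\lambda$ times energy) under variations normal to the submanifold; for an isometric immersion into $\mathbb{E}^N$ the corresponding Euler-Lagrange condition is exactly $\Delta^{\perp}\mathbf{H}-\sum_{i=1}^n h(A_{\mathbf{H}}e_i,e_i)=\lambda\mathbf{H}$. Nonnegative biminimal means biminimal with $\lambda\ge0$. *)

(* Defs.v *)
From HB Require Import structures.
From mathcomp Require Import all_boot all_order all_algebra.
From mathcomp Require Import all_classical all_reals all_analysis.

Set Implicit Arguments.
Unset Strict Implicit.
Unset Printing Implicit Defensive.

Import Order.TTheory GRing.Theory Num.Theory.
Import numFieldNormedType.Exports.

Local Open Scope classical_set_scope.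
Local Open Scope ring_scope.

(** The library norm on ['rV[R]_n] is the sup norm: it gives the usual topology
    and the usual derivatives, and the Euclidean inner product is [dot]. *)
Definition dot (R : realType) (N : nat) (v w : 'rV[R]_N) : R :=
  \sum_(i < N) v 0 i * w 0 i.

(** [C^k] on an open set [U]: [f] is of class [C^(k+1)] when it is (Frechet)
    differentiable on [U] and its directional derivatives are of class [C^k]. *)
Fixpoint Ck (R : realType) (m p k : nat) (U : set 'rV[R]_m)
    (f : 'rV[R]_m -> 'rV[R]_p) : Prop :=
  if k is k'.+1 then
    (forall u, U u -> differentiable f u) /\
    (forall v : 'rV[R]_m, Ck k' U ('D_v f))
  else forall u, U u -> {for u, continuous f}.

Definition smooth_on (R : realType) (m p : nat) (U : set 'rV[R]_m)
    (f : 'rV[R]_m -> 'rV[R]_p) : Prop := forall k, Ck k U f.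

(** A chart is a homeomorphism from an open set of [T] onto an open set of
    [R^n]; [chart_map] and [chart_inv] are unconstrained outside these sets. *)
Record chart (R : realType) (n : nat) (T : topologicalType) := Chart {
  chart_dom : set T;
  chart_img : set 'rV[R]_n;
  chart_map : T -> 'rV[R]_n;
  chart_inv : 'rV[R]_n -> T;
  chart_dom_open : open chart_dom;
  chart_img_open : open chart_img;
  chart_map_img : forall p, chart_dom p -> chart_img (chart_map p);
  chart_inv_dom : forall u, chart_img u -> chart_dom (chart_inv u);
  chart_mapK : forall p, chart_dom p -> chart_inv (chart_map p) = p;
  chart_invK : forall u, chart_img u -> chart_map (chart_inv u) = u;
  chart_map_cont : forall p, chart_dom p -> {for p, continuous chart_map};
  chart_inv_cont : forall u, chart_img u -> {for u, continuous chart_inv} }.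

(** Smooth manifolds without boundary, of dimension [n]. The atlas need not be
    maximal. *)
Record smooth_manifold (R : realType) (n : nat) := SmoothManifold {
  manifold_space :> topologicalType;
  atlas : set (chart R n manifold_space);
  manifold_hausdorff : hausdorff_space manifold_space;
  manifold_second_countable : @second_countable manifold_space;
  atlas_cover : forall p : manifold_space,
    exists2 c, atlas c & chart_dom c p;
  atlas_compatible : forall c d, atlas c -> atlas d ->
    smooth_on [set u | chart_img c u /\ chart_dom d (chart_inv c u)]
      (chart_map d \o chart_inv c) }.

Definition immersion (R : realType) (n N : nat) (M : smooth_manifold R n)
    (x : M -> 'rV[R]_N) : Prop :=
  forall c, atlas c ->
    smooth_on (chart_img c) (x \o chart_inv c) /\
    (forall u, chart_img c u ->
       forall v, 'D_v (x \o chart_inv c) u = 0 -> v = 0).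

Definition proper_map (R : realType) (n N : nat) (M : smooth_manifold R n)
    (x : M -> 'rV[R]_N) : Prop :=
  forall K : set 'rV[R]_N, compact K -> compact (x @^-1` K).

(** Local geometry of an immersion. In what follows [f] is the expression
    [x \o chart_inv c] of the immersion in a chart; a tangent field is given by
    its components [X : R^n -> R^n] in the coordinate frame of the chart, and a
    vector field along the immersion (for instance a normal field) by a map
    [xi : R^n -> R^N] on the image of the chart. *)

Definition push (R : realType) (n N : nat) (f : 'rV[R]_n -> 'rV[R]_N)
    (X : 'rV[R]_n -> 'rV[R]_n) : 'rV[R]_n -> 'rV[R]_N :=
  fun u => 'D_(X u) f u.

(** The connection [D_X xi] of Euclidean space, along the immersion. *)
Definition Dconn (R : realType) (n N : nat) (X : 'rV[R]_n -> 'rV[R]_n)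
    (xi : 'rV[R]_n -> 'rV[R]_N) : 'rV[R]_n -> 'rV[R]_N :=
  fun u => 'D_(X u) xi u.

Definition metric (R : realType) (n N : nat) (f : 'rV[R]_n -> 'rV[R]_N)
    (u : 'rV[R]_n) : 'M[R]_n :=
  \matrix_(i, j) dot ('D_(delta_mx 0 i) f u) ('D_(delta_mx 0 j) f u).

(** Christoffel symbols [Gamma^k_ij] of the induced metric. *)
Definition christoffel (R : realType) (n N : nat) (f : 'rV[R]_n -> 'rV[R]_N)
    (k i j : 'I_n) (u : 'rV[R]_n) : R :=
  2^-1 * \sum_(l < n) invmx (metric f u) k l *
    ('D_(delta_mx 0 i) (fun w => metric f w j l) u
     + 'D_(delta_mx 0 j) (fun w => metric f w i l) u
     - 'D_(delta_mx 0 l) (fun w => metric f w i j) u).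

(** Levi-Civita connection of the induced metric. *)
Definition nabla (R : realType) (n N : nat) (f : 'rV[R]_n -> 'rV[R]_N)
    (X Y : 'rV[R]_n -> 'rV[R]_n) : 'rV[R]_n -> 'rV[R]_n :=
  fun u => 'D_(X u) Y u +
    \row_k \sum_(i < n) \sum_(j < n) christoffel f k i j u * X u 0 i * Y u 0 j.

(** Second fundamental form, from [D_X Y = nabla_X Y + h(X, Y)]. *)
Definition second_ff (R : realType) (n N : nat) (f : 'rV[R]_n -> 'rV[R]_N)
    (X Y : 'rV[R]_n -> 'rV[R]_n) : 'rV[R]_n -> 'rV[R]_N :=
  fun u => Dconn X (push f Y) u - push f (nabla f X Y) u.

(** Components [Z] of the tangential part of [w]: they are determined by
    [dot (push Z) (d_j f) = dot w (d_j f)] for all [j]. *)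
Definition tangent_part (R : realType) (n N : nat) (f : 'rV[R]_n -> 'rV[R]_N)
    (u : 'rV[R]_n) (w : 'rV[R]_N) : 'rV[R]_n :=
  (\row_j dot w ('D_(delta_mx 0 j) f u)) *m invmx (metric f u).

Definition normal_part (R : realType) (n N : nat) (f : 'rV[R]_n -> 'rV[R]_N)
    (u : 'rV[R]_n) (w : 'rV[R]_N) : 'rV[R]_N :=
  w - 'D_(tangent_part f u w) f u.

(** Weingarten map and normal connection, from
    [D_X xi = - A_xi X + nabla^perp_X xi]. *)
Definition weingarten (R : realType) (n N : nat) (f : 'rV[R]_n -> 'rV[R]_N)
    (xi : 'rV[R]_n -> 'rV[R]_N) (X : 'rV[R]_n -> 'rV[R]_n) :
    'rV[R]_n -> 'rV[R]_n :=
  fun u => - tangent_part f u (Dconn X xi u).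

Definition nabla_perp (R : realType) (n N : nat) (f : 'rV[R]_n -> 'rV[R]_N)
    (X : 'rV[R]_n -> 'rV[R]_n) (xi : 'rV[R]_n -> 'rV[R]_N) :
    'rV[R]_n -> 'rV[R]_N :=
  fun u => normal_part f u (Dconn X xi u).

Definition orthonormal_frame (R : realType) (n N : nat)
    (f : 'rV[R]_n -> 'rV[R]_N) (V : set 'rV[R]_n)
    (e : 'I_n -> 'rV[R]_n -> 'rV[R]_n) : Prop :=
  (forall i, smooth_on V (e i)) /\
  (forall u, V u -> forall i j,
     dot (push f (e i) u) (push f (e j) u) = (i == j)%:R).

Definition mean_curvature (R : realType) (n N : nat)
    (f : 'rV[R]_n -> 'rV[R]_N) (e : 'I_n -> 'rV[R]_n -> 'rV[R]_n) :
    'rV[R]_n -> 'rV[R]_N :=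
  fun u => n%:R^-1 *: \sum_(i < n) second_ff f (e i) (e i) u.

Definition normal_laplacian (R : realType) (n N : nat)
    (f : 'rV[R]_n -> 'rV[R]_N) (e : 'I_n -> 'rV[R]_n -> 'rV[R]_n)
    (xi : 'rV[R]_n -> 'rV[R]_N) : 'rV[R]_n -> 'rV[R]_N :=
  fun u => \sum_(i < n)
    (nabla_perp f (e i) (nabla_perp f (e i) xi) u
     - nabla_perp f (nabla f (e i) (e i)) xi u).

(** [P f e u] holds for every local expression [f] of [x] in a chart, every
    orthonormal frame [e] on an open subset [V] of the image of the chart, and
    every [u] in [V]; every point of the manifold is reached in this way, since
    orthonormal frames exist locally. *)
Definition local_frames_hold (R : realType) (n N : nat)
    (M : smooth_manifold R n) (x : M -> 'rV[R]_N)
    (P : ('rV[R]_n -> 'rV[R]_N) -> ('I_n -> 'rV[R]_n -> 'rV[R]_n) ->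
         'rV[R]_n -> Prop) : Prop :=
  forall c, atlas c ->
  forall V : set 'rV[R]_n, open V -> V `<=` chart_img c ->
  forall e, orthonormal_frame (x \o chart_inv c) V e ->
  forall u, V u -> P (x \o chart_inv c) e u.

Definition biminimal (R : realType) (n N : nat) (M : smooth_manifold R n)
    (x : M -> 'rV[R]_N) (lambda : R) : Prop :=
  local_frames_hold x (fun f e u =>
    let H := mean_curvature f e in
    normal_laplacian f e H u
      - \sum_(i < n) second_ff f (weingarten f H (e i)) (e i) u
    = lambda *: H u).

Definition nonnegative_biminimal (R : realType) (n N : nat)
    (M : smooth_manifold R n) (x : M -> 'rV[R]_N) : Prop :=
  exists lambda : R, 0 <= lambda /\ biminimal x lambda.

Definition minimal (R : realType) (n N : nat) (M : smooth_manifold R n)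
    (x : M -> 'rV[R]_N) : Prop :=
  local_frames_hold x (fun f e u => mean_curvature f e u = 0).

(* Main.v *)
Require Import Defs.
From HB Require Import structures.
From mathcomp Require Import all_boot all_order all_algebra.
From mathcomp Require Import all_classical all_reals all_analysis.
From mathcomp Require Import ring lra.

(** Write [H] for the mean curvature vector. The proof is a maximum principle
    for the function [F = (r - |x|^2)^2 |H|^2] on the set [|x|^2 <= r], which is
    compact because the immersion is proper; so [F] attains its maximum there.

    In an orthonormal frame let [lap = sum_i (e_i e_i - nabla_(e_i) e_i)] be the
    Laplacian of functions. Two identities drive the estimate. First, applied to
    the immersion itself the same operator gives [n H], hence [lap |x|^2 = 2 n
    (1 + <x, H>)] ([lap_dist_gap]). Second, since [H] is normal, [lap |H|^2 = 2
    <normal Laplacian of H, H> + 2 |nabla^perp H|^2] ([lap_mean_sqr]); the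
    biminimal equation replaces the first term by [2 lambda |H|^2 + 2 |A_H|^2],
    and [|A_H|^2 >= (tr A_H)^2 / n = n |H|^4], so that [lap |H|^2 >= 2 n |H|^4]
    when [lambda >= 0] ([bochner]).

    At an interior maximum of [F] the first derivatives of [F] vanish and [lap F
    <= 0]. Expanding with the Leibniz rule, and bounding the mixed term [<x, H>]
    by completing a square, gives [F <= 28 r] at that point ([max_estimate]),
    hence everywhere on [|x|^2 <= r] ([test_fun_bound]). At a fixed point [F]
    grows like [r^2 |H|^2], so letting [r] go to infinity forces [H = 0]
    ([mean_sqr_eq0]).

    Two things have to be supplied before this argument can be run. The equation
    is only given along smooth orthonormal frames, so such frames must exist on
    a whole chart: they come from a smooth Cholesky factorisation of the metric
    ([smooth_cholesky]). And [|H|^2] must be a continuous function on the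
    manifold, although it is computed in charts: its coordinate expression
    ([coord_mean]) agrees with the frame expression ([mean_curvatureE]) and is
    invariant under changes of charts ([coord_mean_transition]). Both the
    normality of the second fundamental form and the symmetry of [A_H] rest on
    the equality of mixed derivatives ([schwarz]). *)

Set Implicit Arguments.
Unset Strict Implicit.
Unset Printing Implicit Defensive.

Import Order.TTheory GRing.Theory Num.Theory.
Import numFieldNormedType.Exports.

Local Open Scope classical_set_scope.
Local Open Scope ring_scope.

(** * Scalar functions of class C^k *)

(** Differentiability is local: the same differential is the linear part of both
    functions, since their increments agree near the point. *)
Lemma near_eq_differentiable (R : realType) (V W : normedModType R)
    (f g : V -> W) (a : V) :
  (\near a, f a = g a) -> differentiable f a -> differentiable g a.
Proof.
move=> fg df.
have fga : f a = g a by exact: nbhs_singleton fg.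
have fg0 : \forall h \near 0, f (h + a) = g (h + a).
  have ca : (fun h : V => h + a) @ (0 : V) --> a.
    rewrite -[X in _ --> X](add0r a).
    by apply: (@continuousD _ _ _ id (cst a)); [exact: cvg_id|exact: cvg_cst].
  by have := ca _ fg.
have [cf ef] := (diff_locallyP a f).1 df.
have eg : g \o shift a = cst (g a) + 'd f a +o_ 0 id.
  apply/eqaddoP => e e0; move/eqaddoP: ef => /(_ e e0) ef.
  near=> h.
  rewrite -[leLHS]/(`|g (h + a) - (g a + 'd f a h)|) -fga.
  rewrite -(_ : f (h + a) = g (h + a)); last by near: h.
  by near: h.
by apply/diff_locallyP; rewrite (diff_unique cf eg).
Unshelve. all: by end_near. Qed.

(** Same recursion as [Ck], for real-valued functions: the algebra of [C^k]
    functions is developed coordinate by coordinate, see [Ck_coordP]. *)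
Fixpoint scalar_Ck (R : realType) (m k : nat) (U : set 'rV[R]_m)
    (phi : 'rV[R]_m -> R) : Prop :=
  if k is k'.+1 then
    (forall u, U u -> differentiable phi u) /\
    (forall v : 'rV[R]_m, scalar_Ck k' U ('D_v phi))
  else forall u, U u -> {for u, continuous phi}.

Definition scalar_smooth (R : realType) (m : nat) (U : set 'rV[R]_m)
  (phi : 'rV[R]_m -> R) : Prop := forall k, scalar_Ck k U phi.

Section calculus.
Variables (R : realType) (m : nat) (U : set 'rV[R]_m).
Hypothesis Uopen : open U.
Implicit Types phi psi : 'rV[R]_m -> R.

(** Identities that hold on an open set may be differentiated there. *)
Lemma open_near_eq T (f g : 'rV[R]_m -> T) (u : 'rV[R]_m) :
  (forall w, U w -> f w = g w) -> U u -> \near u, f u = g u.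
Proof.
move=> fg Uu; near=> w; apply: fg; near: w; exact: open_nbhs_nbhs.
Unshelve. all: by end_near. Qed.

Lemma scalar_Ck_ext k phi psi : (forall u, U u -> phi u = psi u) ->
  scalar_Ck k U phi -> scalar_Ck k U psi.
Proof.
elim: k phi psi => [|k IH] phi psi e.
  move=> c u Uu A; rewrite -(e u Uu) => /(c u Uu) nA.
  by apply: filterS2 (open_near_eq e Uu) nA => w /= <-.
move=> [d D]; split=> [u Uu|v].
  apply: near_eq_differentiable (d u Uu); exact: open_near_eq.
apply: IH (D v) => u Uu; apply: near_eq_derive; exact: open_near_eq.
Qed.

Lemma scalar_Ck_le k phi : scalar_Ck k.+1 U phi -> scalar_Ck k U phi.
Proof.
elim: k phi => [|k IH] phi.
  by move=> [d _] u Uu; exact/differentiable_continuous/d.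
move=> [d D]; split=> // v; exact: IH.
Qed.

Lemma scalar_smooth_diff phi u : scalar_smooth U phi -> U u ->
  differentiable phi u.
Proof. by move=> /(_ 1%N)[+ _]; apply. Qed.

Lemma scalar_smooth_derivable phi u v : scalar_smooth U phi -> U u ->
  derivable phi u v.
Proof. by move=> s Uu; apply: diff_derivable; exact: scalar_smooth_diff. Qed.

Lemma scalar_smooth_cont phi u : scalar_smooth U phi -> U u ->
  {for u, continuous phi}.
Proof. by move=> /(_ 0%N); apply. Qed.

Lemma scalar_smooth_D phi v : scalar_smooth U phi -> scalar_smooth U ('D_v phi).
Proof. by move=> s k; have [_ ] := s k.+1; apply. Qed.

Lemma scalar_smooth_ext phi psi : (forall u, U u -> phi u = psi u) ->
  scalar_smooth U phi -> scalar_smooth U psi.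
Proof. by move=> e s k; apply: scalar_Ck_ext (s k). Qed.

Lemma scalar_Ck_cst k (a : R) : scalar_Ck k U (cst a).
Proof.
elim: k a => [|k IH] a; first by move=> u Uu; exact: cst_continuous.
split=> [u _|v]; first exact: differentiable_cst.
by apply: scalar_Ck_ext (IH 0) => u _; rewrite derive_cst.
Qed.

Lemma scalar_smooth_cst (a : R) : scalar_smooth U (fun=> a).
Proof. by move=> k; exact: scalar_Ck_cst. Qed.

Lemma scalar_Ck_add k phi psi : scalar_Ck k U phi -> scalar_Ck k U psi ->
  scalar_Ck k U (phi + psi).
Proof.
elim: k phi psi => [|k IH] phi psi.
  by move=> c d u Uu; apply: continuousD; [exact: c|exact: d].
move=> [c C] [d D]; split=> [u Uu|v].
  by apply: differentiableD; [exact: c|exact: d].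
apply: scalar_Ck_ext (IH _ _ (C v) (D v)) => u Uu.
by rewrite deriveD//; apply: diff_derivable; [exact: c|exact: d].
Qed.

Lemma scalar_Ck_mul k phi psi : scalar_Ck k U phi -> scalar_Ck k U psi ->
  scalar_Ck k U (phi * psi).
Proof.
elim: k phi psi => [|k IH] phi psi.
  by move=> c d u Uu; apply: continuousM; [exact: c|exact: d].
move=> p q; have [c C] := p; have [d D] := q; split=> [u Uu|v].
  by apply: differentiableM; [exact: c|exact: d].
apply: scalar_Ck_ext (scalar_Ck_add (IH _ _ (scalar_Ck_le p) (D v))
  (IH _ _ (scalar_Ck_le q) (C v))) => u Uu.
by rewrite deriveM//; apply: diff_derivable; [exact: c|exact: d].
Qed.

Lemma scalar_smooth_add phi psi : scalar_smooth U phi -> scalar_smooth U psi ->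
  scalar_smooth U (fun u => phi u + psi u).
Proof. by move=> p q k; exact: scalar_Ck_add. Qed.

Lemma scalar_smooth_mul phi psi : scalar_smooth U phi -> scalar_smooth U psi ->
  scalar_smooth U (fun u => phi u * psi u).
Proof. by move=> p q k; exact: scalar_Ck_mul. Qed.

Lemma scalar_smooth_opp phi : scalar_smooth U phi ->
  scalar_smooth U (fun u => - phi u).
Proof.
move=> p; apply: scalar_smooth_ext
  (scalar_smooth_mul (scalar_smooth_cst (-1)) p) => u _ /=; by rewrite mulN1r.
Qed.

Lemma scalar_smooth_sub phi psi : scalar_smooth U phi -> scalar_smooth U psi ->
  scalar_smooth U (fun u => phi u - psi u).
Proof.
by move=> p q; apply: scalar_smooth_add => //; exact: scalar_smooth_opp.
Qed.

Lemma scalar_smooth_sum (I : Type) (r : seq I) (P : pred I) (F : I ->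
  'rV[R]_m -> R) :
  (forall i, P i -> scalar_smooth U (F i)) ->
    scalar_smooth U (fun u => \sum_(i <- r | P i) F i u).
Proof.
move=> H; elim: r => [|i r IH].
  by apply: scalar_smooth_ext (scalar_smooth_cst 0) => u _; rewrite big_nil.
have [Pi|nPi] := boolP (P i).
  by apply: scalar_smooth_ext (scalar_smooth_add (H i Pi) IH) => u _;
    rewrite big_cons Pi.
by apply: scalar_smooth_ext IH => u _; rewrite big_cons (negbTE nPi).
Qed.

(** The derivative of [1 / phi] is [- D phi / phi^2], which only needs [1 / phi]
    to be of class [C^(k-1)]: induction on [k]. *)
Lemma scalar_Ck_inv k phi : (forall u, U u -> phi u != 0) ->
  scalar_Ck k U phi ->
  scalar_Ck k U (fun u => (phi u)^-1).
Proof.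
move=> n0; elim: k => [|k IH].
  by move=> c u Uu; apply: continuousV; [exact: n0|exact: c].
move=> p; have [c C] := p; split=> [u Uu|v].
  by apply: differentiableV; [exact: c|exact: n0].
have q := IH (scalar_Ck_le p).
apply: scalar_Ck_ext (scalar_Ck_mul
  (scalar_Ck_mul (scalar_Ck_cst k (-1)) (C v)) (scalar_Ck_mul q q)) => u Uu.
rewrite deriveV; [|exact: n0|apply: diff_derivable; exact: c].
rewrite -[LHS]/(-1 * 'D_v phi u * ((phi u)^-1 * (phi u)^-1)).
by rewrite -[RHS]/(- _ * _) -exprVn expr2 mulN1r mulNr mulrC mulNr.
Qed.

Lemma scalar_smooth_inv phi : (forall u, U u -> phi u != 0) ->
  scalar_smooth U phi ->
  scalar_smooth U (fun u => (phi u)^-1).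
Proof. by move=> n0 s k; exact: scalar_Ck_inv. Qed.

Lemma derive_sqrt_comp phi u v : 0 < phi u -> differentiable phi u ->
  differentiable (fun w => Num.sqrt (phi w)) u /\
  'D_v (fun w => Num.sqrt (phi w)) u = (2 * Num.sqrt (phi u))^-1 * 'D_v phi u.
Proof.
move=> p0 d.
have ds : differentiable (Num.sqrt : R -> R) (phi u).
  by apply/derivable1_diffP; have [] := is_derive1_sqrt p0.
have dc : differentiable (Num.sqrt \o phi) u by exact: differentiable_comp.
split=> //.
rewrite -[LHS]/('D_v (Num.sqrt \o phi) u) deriveE// diff_comp//=.
rewrite -(deriveE v d); set y := 'D_v phi u.
have -> : y = y *: (1 : R) by rewrite -[RHS]/(y * 1) mulr1.
rewrite linearZ/= -deriveE// derive_sqrt//.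
by rewrite -[LHS]/(y * _) -[y *: _]/(y * 1) mulr1 mulrC.
Qed.

(** As for the inverse: the derivative is [D phi / (2 sqrt phi)]. *)
Lemma scalar_Ck_sqrt k phi : (forall u, U u -> 0 < phi u) ->
  scalar_Ck k U phi ->
  scalar_Ck k U (fun u => Num.sqrt (phi u)).
Proof.
move=> p0; elim: k => [|k IH].
  by move=> c u Uu; apply: continuous_comp; [exact: c|exact: sqrt_continuous].
move=> p; have [c C] := p; split=> [u Uu|v].
  by have [] := derive_sqrt_comp 0 (p0 u Uu) (c u Uu).
have q : scalar_Ck k U (fun u => 2 * Num.sqrt (phi u)).
  by apply: scalar_Ck_mul (IH (scalar_Ck_le p)); exact: scalar_Ck_cst.
have q' : scalar_Ck k U (fun u => (2 * Num.sqrt (phi u))^-1).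
  by apply: scalar_Ck_inv q => u Uu; rewrite gt_eqF// mulr_gt0// sqrtr_gt0 p0.
apply: scalar_Ck_ext (scalar_Ck_mul q' (C v)) => u Uu.
by have [_ ->] := derive_sqrt_comp v (p0 u Uu) (c u Uu).
Qed.

Lemma scalar_smooth_sqrt phi : (forall u, U u -> 0 < phi u) ->
  scalar_smooth U phi ->
  scalar_smooth U (fun u => Num.sqrt (phi u)).
Proof. by move=> n0 s k; exact: scalar_Ck_sqrt. Qed.

End calculus.

(** * Directional derivatives, Schwarz and the second derivative test *)

Section vector_calculus.
Variables (R : realType) (m : nat).
Implicit Types (u v w : 'rV[R]_m) (U : set 'rV[R]_m).

Lemma derive_dir (W : normedModType R) (f : 'rV[R]_m -> W) u v :
  differentiable f u ->
  'D_v f u = \sum_(j < m) v 0 j *: 'D_(delta_mx 0 j) f u.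
Proof.
move=> d; rewrite deriveE// {1}(row_sum_delta v) linear_sum.
by apply: eq_bigr => j _; rewrite linearZ deriveE.
Qed.

Lemma derive_dirD (W : normedModType R) (f : 'rV[R]_m -> W) u v w :
  differentiable f u -> 'D_(v + w) f u = 'D_v f u + 'D_w f u.
Proof. by move=> d; rewrite !deriveE// linearD. Qed.

Lemma derive_dirZ (W : normedModType R) (f : 'rV[R]_m -> W) u a v :
  differentiable f u -> 'D_(a *: v) f u = a *: 'D_v f u.
Proof. by move=> d; rewrite !deriveE// linearZ. Qed.

Lemma derive_dir_sum (W : normedModType R) (f : 'rV[R]_m -> W) u (I : finType)
    (a : I -> R) (e : I -> 'rV[R]_m) :
  differentiable f u ->
  'D_(\sum_i a i *: e i) f u = \sum_i a i *: 'D_(e i) f u.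
Proof.
move=> d; rewrite deriveE// linear_sum.
by apply: eq_bigr => j _; rewrite linearZ deriveE.
Qed.

Lemma differentiable_coordP p (f : 'rV[R]_m -> 'rV[R]_p) u :
  differentiable f u <-> forall j, differentiable (fun w => f w 0 j) u.
Proof.
split=> [d j|H].
  apply: (@differentiable_comp _ _ _ _ f (fun N : 'rV[R]_p => N 0 j)) => //.
  exact: differentiable_coord.
have -> : f = \sum_(j < p) (fun w => f w 0 j *: (delta_mx 0 j : 'rV[R]_p)).
  by apply/funext => w; rewrite fct_sumE -row_sum_delta.
by apply: differentiable_sum => j; exact: differentiableZl.
Qed.

Lemma derive_coord p (f : 'rV[R]_m -> 'rV[R]_p) u v j :
  differentiable f u -> ('D_v f u) 0 j = 'D_v (fun w => f w 0 j) u.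
Proof. by move=> d; rewrite derive_mx ?mxE//; exact: diff_derivable. Qed.

Lemma continuous_coordP (T : topologicalType) p (f : T -> 'rV[R]_p) (a : T) :
  {for a, continuous f} <-> forall j, {for a, continuous (fun b => f b 0 j)}.
Proof.
split=> [d j|H].
  apply: (@continuous_comp _ _ _ f (fun N : 'rV[R]_p => N 0 j)) => //.
  exact: coord_continuous.
have -> : f = \sum_(j < p) (fun b => f b 0 j *: (delta_mx 0 j : 'rV[R]_p)).
  by apply/funext => b; rewrite fct_sumE -row_sum_delta.
elim/big_ind : _ => [|F G cF cG|j _].
- exact: cst_continuous.
- exact: continuousD.
- apply: continuousZr_tmp; exact: H.
Qed.

Section on_open.
Variable U : set 'rV[R]_m.
Hypothesis Uopen : open U.

Lemma Ck_coordP p k (f : 'rV[R]_m -> 'rV[R]_p) :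
  Ck k U f <-> forall j, scalar_Ck k U (fun w => f w 0 j).
Proof.
elim: k f => [|k IH] f.
  split=> [c j u Uu|c u Uu].
    by move/continuous_coordP: (c u Uu); exact.
  by apply/continuous_coordP => j; exact: c.
split=> [[d D] j|H].
  split=> [u Uu|v].
    by move/differentiable_coordP: (d u Uu); exact.
  apply: scalar_Ck_ext (proj1 (IH _) (D v) j) => // u Uu.
  by rewrite derive_coord//; exact: d.
have d : forall u, U u -> differentiable f u.
  by move=> u Uu; apply/differentiable_coordP => j; exact: (proj1 (H j)).
split=> // v; apply/IH => j.
apply: scalar_Ck_ext (proj2 (H j) v) => // u Uu.
by rewrite derive_coord//; exact: d.
Qed.

Lemma smooth_onP p (f : 'rV[R]_m -> 'rV[R]_p) :
  smooth_on U f <-> forall j, scalar_smooth U (fun w => f w 0 j).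
Proof.
split=> [s j k|s k]; first by move/Ck_coordP: (s k); exact.
by apply/Ck_coordP => j; exact: s.
Qed.

Lemma smooth_diff p (f : 'rV[R]_m -> 'rV[R]_p) u :
  smooth_on U f -> U u -> differentiable f u.
Proof. by move=> /(_ 1%N)[+ _]; exact. Qed.

Lemma smooth_D p (f : 'rV[R]_m -> 'rV[R]_p) v :
  smooth_on U f -> smooth_on U ('D_v f).
Proof. by move=> s k; have [_ ] := s k.+1; exact. Qed.

Lemma smooth_scale p (a : 'rV[R]_m -> R) (f : 'rV[R]_m -> 'rV[R]_p) :
  scalar_smooth U a -> smooth_on U f -> smooth_on U (fun u => a u *: f u).
Proof.
move=> sa /smooth_onP sf; apply/smooth_onP => j.
by apply: scalar_smooth_ext (scalar_smooth_mul Uopen sa (sf j)) => // u Uu;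
  rewrite mxE.
Qed.

Lemma smooth_sub p (f g : 'rV[R]_m -> 'rV[R]_p) :
  smooth_on U f -> smooth_on U g -> smooth_on U (fun u => f u - g u).
Proof.
move=> /smooth_onP sf /smooth_onP sg; apply/smooth_onP => j.
by apply: scalar_smooth_ext (scalar_smooth_sub Uopen (sf j) (sg j)) => // u Uu;
  rewrite !mxE.
Qed.

Lemma smooth_sum p (I : finType) (F : I -> 'rV[R]_m -> 'rV[R]_p) :
  (forall i, smooth_on U (F i)) -> smooth_on U (fun u => \sum_i F i u).
Proof.
move=> sF; apply/smooth_onP => j.
apply: scalar_smooth_ext (@scalar_smooth_sum _ _ _ Uopen _ (index_enum I) xpredT
  (fun i u => F i u 0 j) _) => // [u Uu|i _]; first by rewrite summxE.
by have /smooth_onP := sF i; exact.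
Qed.

Lemma smooth_ext p (f g : 'rV[R]_m -> 'rV[R]_p) :
  (forall u, U u -> f u = g u) -> smooth_on U f -> smooth_on U g.
Proof.
move=> e /smooth_onP s; apply/smooth_onP => j.
by apply: scalar_smooth_ext (s j) => // u Uu; rewrite e.
Qed.

(** The direction may vary: expand it in the coordinate basis. *)
Lemma smooth_Ddir p (X : 'rV[R]_m -> 'rV[R]_m) (f : 'rV[R]_m -> 'rV[R]_p) :
  smooth_on U X -> smooth_on U f -> smooth_on U (fun u => 'D_(X u) f u).
Proof.
move=> /smooth_onP sX sf.
apply: (@smooth_ext _ (fun u => \sum_j X u 0 j *: 'D_(delta_mx 0 j) f u)).
  by move=> u Uu; rewrite -derive_dir//; exact: smooth_diff.
by apply: smooth_sum => j; apply: smooth_scale => //; exact: smooth_D.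
Qed.

Lemma scalar_smooth_Ddir (X : 'rV[R]_m -> 'rV[R]_m) (phi : 'rV[R]_m -> R) :
  smooth_on U X -> scalar_smooth U phi ->
    scalar_smooth U (fun u => 'D_(X u) phi u).
Proof.
move=> /smooth_onP sX sf.
apply: (@scalar_smooth_ext _ _ _ Uopen
  (fun u => \sum_j X u 0 j * 'D_(delta_mx 0 j) phi u)).
  by move=> u Uu; rewrite derive_dir//; exact: scalar_smooth_diff sf Uu.
by apply: scalar_smooth_sum => // j _; apply: scalar_smooth_mul => //; exact:
  scalar_smooth_D.
Qed.

Lemma scalar_smooth_dot p (f g : 'rV[R]_m -> 'rV[R]_p) :
  smooth_on U f -> smooth_on U g -> scalar_smooth U (fun u => dot (f u) (g u)).
Proof.
move=> /smooth_onP sf /smooth_onP sg.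
by apply: scalar_smooth_sum => // i _; exact: scalar_smooth_mul.
Qed.

End on_open.

Lemma derive_sum_fun (W : normedModType R) (I : finType)
    (F : I -> 'rV[R]_m -> W) u v :
  (forall i, differentiable (F i) u) ->
  differentiable (fun w => \sum_i F i w) u /\
  'D_v (fun w => \sum_i F i w) u = \sum_i 'D_v (F i) u.
Proof.
move=> d; rewrite -!big_enum/=.
rewrite (_ : (fun w => _) = (fun w => \sum_(i <- enum I) F i w)); last first.
  by apply/funext => w; rewrite big_enum.
elim: (enum I) => [|i s [IH1 IH2]].
  under eq_fun do rewrite big_nil; rewrite big_nil; split.
    exact: differentiable_cst.
  by rewrite derive_cst.
have e : (fun w => \sum_(j <- i :: s) F j w) =
    F i + (fun w => \sum_(j <- s) F j w).
  by apply/funext => w; rewrite big_cons.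
split; rewrite e; first exact: differentiableD.
by rewrite deriveD ?IH2 ?big_cons//; exact: diff_derivable.
Qed.

Lemma derive_mul (f g : 'rV[R]_m -> R) u v :
  differentiable f u -> differentiable g u ->
  'D_v (fun w => f w * g w) u = 'D_v f u * g u + f u * 'D_v g u.
Proof.
move=> df dg; rewrite [LHS](@deriveM _ _ f g); [|exact: diff_derivable..].
by rewrite addrC -[_ *: _]/(g u * _) [g u * _]mulrC.
Qed.

Lemma derive_dot p (A B : 'rV[R]_m -> 'rV[R]_p) u v :
  differentiable A u -> differentiable B u ->
  'D_v (fun w => dot (A w) (B w)) u =
    dot ('D_v A u) (B u) + dot (A u) ('D_v B u).
Proof.
move=> dA dB; rewrite /dot.
have dAi i : differentiable (fun w => A w 0 i) u.
  by move/differentiable_coordP: dA; exact.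
have dBi i : differentiable (fun w => B w 0 i) u.
  by move/differentiable_coordP: dB; exact.
have [_ ->] := @derive_sum_fun _ _ (fun i w => A w 0 i * B w 0 i) u v
  (fun i => differentiableM (dAi i) (dBi i)).
rewrite -big_split/=; apply: eq_bigr => i _.
by rewrite derive_mul// !derive_coord.
Qed.

Lemma derive_scale p (a : 'rV[R]_m -> R) (A : 'rV[R]_m -> 'rV[R]_p) u v :
  differentiable a u -> differentiable A u ->
  differentiable (fun w => a w *: A w) u /\
  'D_v (fun w => a w *: A w) u = 'D_v a u *: A u + a u *: 'D_v A u.
Proof.
move=> da dA.
have dAi i : differentiable (fun w => A w 0 i) u.
  by move/differentiable_coordP: dA; exact.
have E i : (fun w => (a w *: A w) 0 i) = (fun w => a w * A w 0 i).
  by apply/funext => w; rewrite mxE.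
have d : differentiable (fun w => a w *: A w) u.
  by apply/differentiable_coordP => i; rewrite E; exact: differentiableM.
split=> //; apply/rowP => i; rewrite derive_coord// E derive_mul// !mxE.
by rewrite derive_coord.
Qed.

Lemma derive_chain (k : nat) (W : normedModType R) (f : 'rV[R]_k -> W)
    (t : 'rV[R]_m -> 'rV[R]_k) u v :
  differentiable t u -> differentiable f (t u) ->
  'D_v (fun w => f (t w)) u = 'D_('D_v t u) f (t u).
Proof.
move=> dt df; rewrite -[LHS]/('D_v (f \o t) u) deriveE; last first.
  exact: differentiable_comp.
by rewrite diff_comp//= !deriveE.
Qed.

(** Reduces directional derivatives to derivatives of one variable. *)
Lemma is_derive_line (f : 'rV[R]_m -> R) u v t :
  differentiable f (u + t *: v) ->
  is_derive t 1 (fun s : R => f (u + s *: v)) ('D_v f (u + t *: v)).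
Proof.
move=> /(@diff_derivable _ _ _ _ _ v) d.
have e : (fun h : R => h^-1 *: (f (u + (h *: 1 + t) *: v) - f (u + t *: v))) =
         (fun h : R => h^-1 *: (f (h *: v + (u + t *: v)) - f (u + t *: v))).
  apply/funext => h; congr (_ *: (f _ - _)).
  by rewrite -[h *: 1]/(h * 1) mulr1 scalerDl addrCA.
apply: DeriveDef; first by rewrite /derivable e.
by rewrite /derive e.
Qed.

Lemma MVT_line (f : 'rV[R]_m -> R) u v s : 0 < s ->
  (forall t, 0 <= t <= s -> differentiable f (u + t *: v)) ->
  exists2 t, 0 < t < s & f (u + s *: v) - f u = s * 'D_v f (u + t *: v).
Proof.
move=> s0 d.
have H t : t \in `[0, s] ->
    is_derive t 1 (fun s : R => f (u + s *: v)) ('D_v f (u + t *: v)).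
  by rewrite in_itv/= => ts; exact/is_derive_line/d.
have Hoo t : t \in `]0, s[ ->
    is_derive t 1 (fun s : R => f (u + s *: v)) ('D_v f (u + t *: v)).
  by move=> ts; apply: H; move: t ts; exact: subset_itv_oo_cc.
have coord_mean : {within `[0, s], continuous (fun s : R => f (u + s *: v))}.
  apply: derivable_within_continuous => t ts; have [] := H t ts; exact.
have [t] := MVT s0 Hoo coord_mean.
rewrite in_itv/= => ts; rewrite scale0r addr0 subr0 => E.
by exists t; rewrite // E mulrC.
Qed.

(** An open set around [u] contains a small parallelogram spanned by [v] and
    [w]: the room needed for second differences and for segments. *)
Lemma open_square (O : set 'rV[R]_m) u v w : open O -> O u ->
  exists2 d : R, 0 < d & forall s t, `|s| <= d -> `|t| <= d ->
    O (u + s *: v + t *: w).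
Proof.
move=> Oo Ou; have /nbhs_ballP[r /= r0 rO] : nbhs u O by exact: open_nbhs_nbhs.
have n0 : 0 < `|v| + `|w| + 1 by rewrite ltr_wpDl// addr_ge0.
exists (r / 2 / (`|v| + `|w| + 1)); first by rewrite !divr_gt0.
move=> s t sd td; apply: rO; rewrite -ball_normE /=.
rewrite opprD opprD !addrA subrr add0r -opprD normrN.
apply: le_lt_trans (ler_normD _ _) _; rewrite !normrZ.
apply: (@le_lt_trans _ _ (r / 2 / (`|v| + `|w| + 1) * (`|v| + `|w| + 1))).
  rewrite !mulrDr mulr1 -[leLHS]addr0 lerD//; last by rewrite !divr_ge0 ?ltW.
  by rewrite lerD// ler_wpM2r.
by rewrite divfK ?gt_eqF// ltr_pdivrMr// ltr_pMr// ltr1n.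
Qed.

Section schwarz.
Variable U : set 'rV[R]_m.
Hypothesis Uopen : open U.

(** The mean value theorem used twice, along [v] for the increment of [f] in the
    direction [w], then along [w] for its derivative. *)
Lemma second_difference (f : 'rV[R]_m -> R) u v w d : scalar_smooth U f ->
  0 < d ->
  (forall s t, `|s| <= d -> `|t| <= d -> U (u + s *: v + t *: w)) ->
  exists s t, [/\ `|s| <= d, `|t| <= d &
   f (u + d *: v + d *: w) - f (u + d *: v) - (f (u + d *: w) - f u)
   = d * d * 'D_w ('D_v f) (u + s *: v + t *: w)].
Proof.
move=> sf d0 H; pose g := fun x => f (x + d *: w) - f x.
have le1 t : 0 <= t <= d -> `|t| <= d by case/andP => t0 td; rewrite ger0_norm.
have H0 s : `|s| <= d -> U (u + s *: v).
  by move=> sd; rewrite -[_ + _]addr0 -(scale0r w); apply: H;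
    rewrite // normr0 ltW.
have dd : `|d| <= d by rewrite gtr0_norm.
have dsh x : U (x + d *: w) -> differentiable (fun x => f (x + d *: w)) x.
  move=> Ux; apply: (@differentiable_comp _ _ _ _ (fun x => x + d *: w)) => //.
  exact: scalar_smooth_diff sf Ux.
have [|s /andP[s0 sd] E] := @MVT_line g u v d d0.
  move=> s /le1 sd; apply: differentiableB; first by apply: dsh; exact: H.
  by apply: scalar_smooth_diff sf _; exact: H0.
have sd' : `|s| <= d by apply: le1; rewrite !ltW.
have Dsh : 'D_v (fun x => f (x + d *: w)) (u + s *: v)
    = 'D_v f (u + s *: v + d *: w).
  apply: etrans (@derive_chain _ _ f (fun x => x + d *: w) _ _ _ _) _ => //.
    by apply: scalar_smooth_diff sf _; exact: H.
  rewrite (@deriveD _ _ _ id (cst (d *: w))) ?derive_id ?derive_cst ?addr0//.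
have Dg : 'D_v g (u + s *: v)
    = 'D_v f (u + s *: v + d *: w) - 'D_v f (u + s *: v).
  rewrite -Dsh; apply: deriveB; apply: diff_derivable.
  - by apply: dsh; exact: H.
  - by apply: scalar_smooth_diff sf _; exact: H0.
have [|t /andP[t0 td] E2] := @MVT_line ('D_v f) (u + s *: v) w d d0.
  by move=> t /le1 td; apply: scalar_smooth_diff (scalar_smooth_D _ sf) _;
    exact: H.
exists s, t; split=> //; first by apply: le1; rewrite !ltW.
by rewrite -mulrA -E2 -Dg -E /g.
Qed.

(** The second difference of [f] is symmetric in [v] and [w], and it is a value
    of either mixed derivative near [u]; conclude by continuity. *)
Lemma schwarz (f : 'rV[R]_m -> R) u v w : scalar_smooth U f -> U u ->
  'D_v ('D_w f) u = 'D_w ('D_v f) u.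
Proof.
move=> sf Uu; apply/eqP; rewrite -subr_eq0 -normr_le0.
apply/ler_addgt0Pr => e e0; rewrite add0r.
have c1 := scalar_smooth_cont (scalar_smooth_D v (scalar_smooth_D w sf)) Uu.
have c2 := scalar_smooth_cont (scalar_smooth_D w (scalar_smooth_D v sf)) Uu.
have e20 : 0 < e / 2 by rewrite divr_gt0.
pose A := [set x | U x /\ `|'D_v ('D_w f) u - 'D_v ('D_w f) x| < e / 2
   /\ `|'D_w ('D_v f) u - 'D_w ('D_v f) x| < e / 2].
have nA : nbhs u A.
  have n0 : nbhs u U by exact: open_nbhs_nbhs.
  move/cvgrPdist_lt: c1 => /(_ _ e20) n1.
  move/cvgrPdist_lt: c2 => /(_ _ e20) n2.
  apply: filterS3 _ n0 n1 n2 => x Ux.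
  move=> h1 h2.
  split.
  exact: Ux.
  split.
  exact: h1.
  exact: h2.

have [d d0 H] := @open_square _ u v w (@open_interior _ A) nA.
have HU s t : `|s| <= d -> `|t| <= d -> U (u + s *: v + t *: w).
  by move=> sd td; have /interior_subset[] := H _ _ sd td.
have HU' s t : `|s| <= d -> `|t| <= d -> U (u + s *: w + t *: v).
  by move=> sd td; rewrite addrAC; exact: HU.
have [s [t [sd td E]]] := second_difference sf d0 HU.
have [s' [t' [sd' td' E']]] := second_difference sf d0 HU'.
(* The second difference is the same when [v] and [w] are exchanged. *)
have XX : f (u + d *: v + d *: w) - f (u + d *: v) - (f (u + d *: w) - f u) =
    f (u + d *: w + d *: v) - f (u + d *: w) - (f (u + d *: v) - f u).
  by rewrite (addrAC u (d *: w)) !opprB addrACA [RHS]addrACA; congr (_ + _);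
    rewrite addrC.
have := etrans (esym E) (etrans XX E').
have dd0 : d * d != 0 by rewrite mulf_neq0 ?gt_eqF.
move=> /(mulfI dd0) EE.
have /interior_subset[_ [_ h1]] := H _ _ sd td.
have /interior_subset[_ [h2 _]] := H _ _ td' sd'.
rewrite EE in h1.
have AC : u + t' *: v + s' *: w = u + s' *: w + t' *: v by rewrite addrAC.
rewrite AC in h2.
move: h1 h2; move: {EE XX E E'}('D_v ('D_w f) (_ + _)) => r h1 h2.
rewrite (splitr e) -(subrKA r).
apply: le_trans (ler_normD _ _) (lerD (ltW h2) _).
by rewrite distrC; exact: ltW h1.
Qed.

Lemma local_max_critical (f : 'rV[R]_m -> R) u v : scalar_smooth U f -> U u ->
  (\forall x \near u, f x <= f u) -> 'D_v f u = 0.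
Proof.
move=> sf Uu fu.
have nA : nbhs u [set x | U x /\ f x <= f u].
  have n0 : nbhs u U by exact: open_nbhs_nbhs.
  by apply: filterS2 _ n0 fu => x.
have [d d0 H] := @open_square _ u v 0 (@open_interior _ _) nA.
have H' t : t \in `](- d), d[%R -> U (u + t *: v) /\ f (u + t *: v) <= f u.
  rewrite in_itv/= => /andP[t1 t2].
  have td : `|t| <= d by rewrite ler_norml !ltW.
  have zd : `|0 : R| <= d by rewrite normr0 ltW.
  by have /interior_subset := H t 0 td zd; rewrite scaler0 addr0.
have [_ <-] : is_derive (0 : R) 1 (fun t : R => f (u + t *: v)) 0.
  apply: (@derive1_at_max _ _ (- d) d).
  - by rewrite ge0_cp// ltW.
  - move=> t /H'[Ut _]; have := is_derive_line (scalar_smooth_diff sf Ut).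
    by move=> dl; exact: ex_derive.
  - by rewrite in_itv/= oppr_lt0 d0.
  - by move=> t /H'[_]; rewrite scale0r addr0.
have [_ ->] : is_derive (0 : R) 1 (fun t => f (u + t *: v))
  ('D_v f (u + 0 *: v)).
  by apply: is_derive_line; rewrite scale0r addr0; exact:
    scalar_smooth_diff sf Uu.
by rewrite scale0r addr0.
Qed.

(** Otherwise the second derivative is positive near [u] along [v], and two mean
    values show that [f] increases from [u] along [v]. *)
Lemma local_max_second (f : 'rV[R]_m -> R) u v : scalar_smooth U f -> U u ->
  (\forall x \near u, f x <= f u) -> 'D_v ('D_v f) u <= 0.
Proof.
move=> sf Uu fu; rewrite leNgt; apply/negP => pos.
have D0 := local_max_critical v sf Uu fu.
have c := scalar_smooth_cont (scalar_smooth_D v (scalar_smooth_D v sf)) Uu.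
have nA : nbhs u [set x | [/\ U x, f x <= f u & 0 < 'D_v ('D_v f) x]].
  have n0 : nbhs u U by exact: open_nbhs_nbhs.
  move/cvgr_gt: c => /(_ _ pos) n1.
  by apply: filterS3 _ n0 fu n1 => x.
have [d d0 H] := @open_square _ u v 0 (@open_interior _ _) nA.
have H' t : 0 <= t <= d ->
   [/\ U (u + t *: v), f (u + t *: v) <= f u & 0 < 'D_v ('D_v f) (u + t *: v)].
  move=> /andP[t1 t2].
  have td : `|t| <= d by rewrite ger0_norm.
  have zd : `|0 : R| <= d by rewrite normr0 ltW.
  by have /interior_subset := H t 0 td zd; rewrite scaler0 addr0.
have [|t /andP[t0 td] E] := @MVT_line f u v d d0.
  by move=> t /H'[Ut _ _]; exact: scalar_smooth_diff sf Ut.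
have [|s /andP[s0 st] E'] := @MVT_line ('D_v f) u v t t0.
  move=> s /andP[s0 st].
  have /H'[Us _ _] : 0 <= s <= d by rewrite s0 (le_trans st)// ltW.
  exact: scalar_smooth_diff (scalar_smooth_D v sf) Us.
have /H'[_ _ p] : 0 <= s <= d by rewrite ltW//= ltW// (lt_trans st).
have /H'[_ + _] : 0 <= d <= d by rewrite ltW/=.
rewrite -subr_le0 E; move: E'; rewrite D0 subr0 => ->.
by rewrite leNgt !mulr_gt0.
Qed.

End schwarz.

Lemma schwarz_vec p (U : set 'rV[R]_m) (f : 'rV[R]_m -> 'rV[R]_p) u v w :
  open U -> smooth_on U f -> U u -> 'D_v ('D_w f) u = 'D_w ('D_v f) u.
Proof.
move=> Uo sf Uu; apply/rowP => j.
have D x y : ('D_x ('D_y f) u) 0 j = 'D_x ('D_y (fun z => f z 0 j)) u.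
  rewrite derive_coord; last exact: smooth_diff (smooth_D _ sf) Uu.
  apply: near_eq_derive; apply: open_near_eq Uu => // z Uz.
  by rewrite derive_coord//; exact: smooth_diff sf Uz.
have /(_ j) sfj := (smooth_onP Uo f).1 sf.
exact: etrans (D v w) (etrans (schwarz Uo v w sfj Uu) (esym (D w v))).
Qed.

End vector_calculus.

(** * Inner product and smooth orthonormalisation *)

Section dot_theory.
Variables (R : realType) (N : nat).
Implicit Types v w : 'rV[R]_N.

Lemma dotC v w : dot v w = dot w v.
Proof. by apply: eq_bigr => i _; rewrite mulrC. Qed.

Lemma dotDl v1 v2 w : dot (v1 + v2) w = dot v1 w + dot v2 w.
Proof. by rewrite -big_split; apply: eq_bigr => i _; rewrite mxE mulrDl. Qed.

Lemma dotZl a v w : dot (a *: v) w = a * dot v w.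
Proof. by rewrite mulr_sumr; apply: eq_bigr => i _; rewrite mxE mulrA. Qed.

Lemma dotNl v w : dot (- v) w = - dot v w.
Proof. by rewrite -scaleN1r dotZl mulN1r. Qed.

Lemma dotBl v1 v2 w : dot (v1 - v2) w = dot v1 w - dot v2 w.
Proof. by rewrite dotDl dotNl. Qed.

Lemma dot0l w : dot 0 w = 0.
Proof. by rewrite -(scale0r 0) dotZl mul0r. Qed.

Lemma dot_suml (I : Type) (r : seq I) (P : pred I) (F : I -> 'rV[R]_N) w :
  dot (\sum_(i <- r | P i) F i) w = \sum_(i <- r | P i) dot (F i) w.
Proof.
by elim/big_rec2 : _ => [|i y x _ <-]; [exact: dot0l|rewrite dotDl].
Qed.

Lemma dotZr a v w : dot v (a *: w) = a * dot v w.
Proof. by rewrite dotC dotZl dotC. Qed.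

Lemma dotBr v w1 w2 : dot v (w1 - w2) = dot v w1 - dot v w2.
Proof. by rewrite dotC dotBl !(dotC v). Qed.

Lemma dot0r v : dot v 0 = 0.
Proof. by rewrite dotC dot0l. Qed.

Lemma dot_sumr (I : Type) (r : seq I) (P : pred I) (F : I -> 'rV[R]_N) v :
  dot v (\sum_(i <- r | P i) F i) = \sum_(i <- r | P i) dot v (F i).
Proof. by rewrite dotC dot_suml; apply: eq_bigr => i _; rewrite dotC. Qed.

Lemma dot_ge0 v : 0 <= dot v v.
Proof. by apply: sumr_ge0 => i _; rewrite -expr2 sqr_ge0. Qed.

Lemma dot_eq0 v : dot v v = 0 -> v = 0.
Proof.
move=> /eqP; rewrite psumr_eq0; last by move=> i _; rewrite -expr2 sqr_ge0.
move=> /allP H; apply/rowP => i; rewrite mxE; apply/eqP.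
by have := H i; rewrite mem_index_enum => /(_ isT); rewrite mulf_eq0 orbb.
Qed.

Lemma cauchy_schwarz v w : dot v w ^+ 2 <= dot v v * dot w w.
Proof.
have [w0|w0] := eqVneq (dot w w) 0.
  by rewrite (dot_eq0 w0) !dot0r expr0n/= mulr0.
have wp : 0 < dot w w by rewrite lt_def w0 dot_ge0.
have := dot_ge0 (dot w w *: v - dot v w *: w).
rewrite !(dotBl, dotBr, dotZl, dotZr) (dotC w v) => H.
by rewrite -subr_ge0 -(pmulr_rge0 _ wp); move: H; congr (0 <= _); ring.
Qed.

End dot_theory.

Section cholesky.
Variables (R : realType) (m : nat) (U : set 'rV[R]_m).
Hypothesis Uopen : open U.

Definition mx_smooth p q (A : 'rV[R]_m -> 'M[R]_(p, q)) :=
  forall i j, scalar_smooth U (fun u => A u i j).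

Lemma mx_smooth_mul p q r (A : 'rV[R]_m -> 'M[R]_(p, q)) (B : 'rV[R]_m ->
  'M[R]_(q, r)) :
  mx_smooth A -> mx_smooth B -> mx_smooth (fun u => A u *m B u).
Proof.
move=> sA sB i j; apply: (@scalar_smooth_ext _ _ _ Uopen
  (fun u => \sum_k A u i k * B u k j)).
  by move=> u _; rewrite mxE.
by apply: scalar_smooth_sum => // k _; exact: scalar_smooth_mul.
Qed.

Lemma mx_smooth_ext p q (A B : 'rV[R]_m -> 'M[R]_(p, q)) :
  (forall u, U u -> A u = B u) -> mx_smooth A -> mx_smooth B.
Proof. by move=> e sA i j; apply: scalar_smooth_ext (sA i j) => // u /e ->. Qed.

Lemma mx_smooth_tr p q (A : 'rV[R]_m -> 'M[R]_(p, q)) : mx_smooth A ->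
  mx_smooth (fun u => (A u)^T).
Proof.
by move=> sA i j; apply: scalar_smooth_ext (sA j i) => // u _; rewrite mxE.
Qed.

Lemma mx_smooth_cst p q (A : 'M[R]_(p, q)) : mx_smooth (fun=> A).
Proof. by move=> i j; exact: scalar_smooth_cst. Qed.

Lemma mx_smooth_scale p q a (A : 'rV[R]_m -> 'M[R]_(p, q)) :
  scalar_smooth U a -> mx_smooth A -> mx_smooth (fun u => a u *: A u).
Proof.
by move=> sa sA i j; apply: scalar_smooth_ext
  (scalar_smooth_mul Uopen sa (sA i j)) => // u _; rewrite mxE.
Qed.

Lemma mx_smooth_sub p q (A B : 'rV[R]_m -> 'M[R]_(p, q)) :
  mx_smooth A -> mx_smooth B -> mx_smooth (fun u => A u - B u).
Proof.
by move=> sA sB i j; apply: scalar_smooth_ext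
  (scalar_smooth_sub Uopen (sA i j) (sB i j)) => // u _;
  rewrite !mxE.
Qed.

Lemma mx_smooth_block p1 p2 q1 q2 (A : 'rV[R]_m -> 'M[R]_(p1, q1))
   (B : 'rV[R]_m -> 'M[R]_(p1, q2)) (C : 'rV[R]_m -> 'M[R]_(p2, q1))
   (D : 'rV[R]_m -> 'M[R]_(p2, q2)) :
  mx_smooth A -> mx_smooth B -> mx_smooth C -> mx_smooth D ->
  mx_smooth (fun u => block_mx (A u) (B u) (C u) (D u)).
Proof.
move=> sA sB scalar_Ck sD i j.
have E u : (block_mx (A u) (B u) (C u) (D u)) i j =
  match fintype.split i, fintype.split j with
  | inl i, inl j => A u i j | inl i, inr j => B u i j
  | inr i, inl j => C u i j | inr i, inr j => D u i j end.
  by rewrite mxE; case: (fintype.split i) => k; rewrite mxE; case: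
    (fintype.split j).
under eq_fun do rewrite E.
by case: (fintype.split i) => k; case: (fintype.split j) => l; move: k l.
Qed.

(** Induction on the size. Eliminating the first row and column of [G] by the
    unipotent matrix [L u] leaves the pivot and the Schur complement [S u],
    which is again smooth, symmetric and positive definite. *)
Lemma smooth_cholesky n (G : 'rV[R]_m -> 'M[R]_n) : mx_smooth G ->
  (forall u, U u -> (G u)^T = G u) ->
  (forall u, U u -> forall v : 'rV[R]_n, v != 0 -> 0 < (v *m G u *m v^T) 0 0) ->
  exists2 e : 'rV[R]_m -> 'M[R]_n,
    mx_smooth e & forall u, U u -> e u *m G u *m (e u)^T = 1%:M.
Proof.
elim: n G => [|n IH] G sG symG posG.
  by exists (fun=> 1%:M); [exact: mx_smooth_cst|move=> u _;
    apply/matrixP => -[]].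
pose a u := (G u) 0 0.
pose b u : 'rV[R]_n := @ursubmx _ 1 n 1 n (G u).
pose C u : 'M[R]_n := @drsubmx _ 1 n 1 n (G u).
pose G' u : 'M[R]_(1 + n) := G u.
have GE u : U u -> G' u = block_mx (a u)%:M (b u) (b u)^T (C u).
  move=> Uu; rewrite -[LHS](@submxK _ 1 n 1 n) /G'; congr block_mx.
    by rewrite [LHS]mx11_scalar !mxE; congr (_%:M); congr (G u _ _);
      apply/val_inj.
  by rewrite /b trmx_ursub; congr dlsubmx; rewrite symG.
have apos u : U u -> 0 < a u.
  move=> Uu; have := posG u Uu (delta_mx 0 0); rewrite -rowE.
  rewrite trmx_delta -colE !mxE; apply.
  by apply/eqP => /rowP/(_ 0)/eqP; rewrite !mxE/= oner_eq0.
have sa : scalar_smooth U a by exact: sG.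
have sb : mx_smooth b.
  move=> i j; apply: scalar_smooth_ext (sG (lshift n i) (rshift 1 j)) => // u _.
  by rewrite /b !mxE.
have scalar_Ck : mx_smooth C.
  move=> i j; apply: scalar_smooth_ext (sG (rshift 1 i) (rshift 1 j)) => // u _.
  by rewrite /C !mxE.
have sai : scalar_smooth U (fun u => (a u)^-1).
  by apply: scalar_smooth_inv => // u Uu; rewrite gt_eqF// apos.
pose S u := C u - (a u)^-1 *: ((b u)^T *m b u).
have sS : mx_smooth S.
  by apply: mx_smooth_sub => //; apply: mx_smooth_scale => //; apply:
    mx_smooth_mul => //; exact: mx_smooth_tr.
pose L u : 'M[R]_(1 + n) := block_mx 1%:M 0 (- ((a u)^-1 *: (b u)^T)) 1%:M.
have sL : mx_smooth L.
  apply: mx_smooth_block; [exact: mx_smooth_cst|exact: mx_smooth_cst| |exact: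
    mx_smooth_cst].
  apply: (@mx_smooth_ext _ _ (fun u => 0 - (a u)^-1 *: (b u)^T)).
    by move=> u _; rewrite sub0r.
  by apply: mx_smooth_sub; [exact: mx_smooth_cst|apply: mx_smooth_scale => //;
    exact: mx_smooth_tr].
have LGL u : U u -> L u *m G' u *m (L u)^T = block_mx (a u)%:M 0 0 (S u).
  move=> Uu; rewrite (GE u Uu) /L (@tr_block_mx _ 1 n 1 n) !mulmx_block.
  rewrite !trmx0 !trmx1 !mul1mx !mul0mx !mulmx0 !mulmx1 !addr0.
  rewrite linearN/= linearZ/= trmxK.
  rewrite mulNmx mul_mx_scalar scalerA mulfV ?gt_eqF ?apos// scale1r addNr.
  rewrite mul0mx add0r mulmxN mul_scalar_mx scalerA mulfV ?gt_eqF ?apos//.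
  by rewrite scale1r addNr mulNmx -scalemxAl /S addrC.
have CT u : U u -> (C u)^T = C u.
  by move=> Uu; rewrite /C trmx_drsub; congr drsubmx; exact: symG.
have [e' se' He'] : exists2 e : 'rV[R]_m -> 'M[R]_n,
    mx_smooth e & forall u, U u -> e u *m S u *m (e u)^T = 1%:M.
  apply: IH => // u Uu.
    by rewrite /S linearB/= linearZ/= trmx_mul trmxK CT.
  (* [L u] maps [(0, w)] to a vector where [G] takes the value of [S] at [w]. *)
  move=> w w0; pose v : 'rV[R]_(1 + n) := row_mx 0 w.
  have := posG u Uu (v *m L u); rewrite -/(G' u).
  have -> : (v *m L u) *m G' u *m (v *m L u)^T =
      v *m (L u *m G' u *m (L u)^T) *m v^T by rewrite trmx_mul !mulmxA.
  have -> : v *m (L u *m G' u *m (L u)^T) *m v^T = w *m S u *m w^T.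
    rewrite LGL// /v mul_row_block !mul0mx !mulmx0 !add0r.
    by rewrite tr_row_mx mul_row_col mul0mx add0r.
  apply; apply: contraNneq w0; rewrite /v /L mul_row_block !mul0mx mulmx1
    !add0r.
  move=> /(congr1 (@rsubmx _ 1 1 n)); rewrite row_mxKr => ->.
  by apply/eqP/rowP => j; rewrite !mxE.
pose D u : 'M[R]_(1 + n) := block_mx (Num.sqrt (a u))^-1%:M 0 0 (e' u).
have sD : mx_smooth D.
  apply: mx_smooth_block => //; [|exact: mx_smooth_cst|exact: mx_smooth_cst].
  move=> i j; rewrite !ord1.
  apply: (@scalar_smooth_ext _ _ _ Uopen (fun u => (Num.sqrt (a u))^-1)).
    by move=> u _; rewrite mxE.
  apply: scalar_smooth_inv => //; last exact: scalar_smooth_sqrt.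
  by move=> u Uu; rewrite gt_eqF// sqrtr_gt0 apos.
exists (fun u => D u *m L u : 'M[R]_n.+1); first exact: mx_smooth_mul.
move=> u Uu; rewrite -/(G' u).
rewrite -[LHS]/((D u *m L u) *m G' u *m (D u *m L u)^T).
have -> : (D u *m L u) *m G' u *m (D u *m L u)^T =
    D u *m (L u *m G' u *m (L u)^T) *m (D u)^T by rewrite trmx_mul !mulmxA.
rewrite LGL// /D (@tr_block_mx _ 1 n 1 n) !mulmx_block.
rewrite !trmx0 !(mul0mx, mulmx0) !(addr0, add0r, mul0mx, mulmx0) He'//.
rewrite tr_scalar_mx -!scalar_mxM.
have -> : (Num.sqrt (a u))^-1 * a u * (Num.sqrt (a u))^-1 = 1.
  have s0 : Num.sqrt (a u) != 0 by rewrite gt_eqF// sqrtr_gt0 apos.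
  rewrite -[X in _ * X * _](@sqr_sqrtr _ (a u)) ?ltW ?apos//.
  by rewrite expr2 mulKf// mulfV.
by rewrite -scalar_mx_block.
Qed.

End cholesky.

(** * Local geometry of an immersion *)

Section geometry.
Variables (R : realType) (n N : nat) (f : 'rV[R]_n -> 'rV[R]_N) (U :
  set 'rV[R]_n).
Hypothesis Uopen : open U.
Hypothesis sf : smooth_on U f.
Hypothesis inj : forall u, U u -> forall v, 'D_v f u = 0 -> v = 0.
Implicit Types (u v w : 'rV[R]_n).

Local Notation d i := ('D_(delta_mx 0 i) f).

Lemma immersion_diff u : U u -> differentiable f u.
Proof. exact: smooth_diff. Qed.

Lemma partial_smooth i : smooth_on U (d i).
Proof. exact: smooth_D. Qed.

Lemma partial_diff i u : U u -> differentiable (d i) u.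
Proof. by move=> Uu; apply: smooth_diff Uu; exact: partial_smooth. Qed.

Lemma metric_smooth : mx_smooth U (metric f).
Proof.
move=> i j; apply: (@scalar_smooth_ext _ _ _ Uopen
  (fun u => dot (d i u) (d j u))).
  by move=> u _; rewrite mxE.
by apply: scalar_smooth_dot => //; exact: partial_smooth.
Qed.

Lemma metric_sym u : (metric f u)^T = metric f u.
Proof. by apply/matrixP => i j; rewrite !mxE; exact: dotC. Qed.

(** The matrix [metric f] is the pull-back of the inner product; positivity and
    invertibility below are the injectivity of the differential of [f]. *)
Lemma metric_dot u v w : U u ->
  (v *m metric f u *m w^T) 0 0 = dot ('D_v f u) ('D_w f u).
Proof.
move=> Uu; rewrite (derive_dir v (immersion_diff Uu))
  (derive_dir w (immersion_diff Uu)).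
rewrite mxE dot_sumr; apply: eq_bigr => j _.
rewrite mxE dot_suml mulr_suml; apply: eq_bigr => i _.
by rewrite !mxE dotZl dotZr; ring.
Qed.

Lemma metric_pos u v : U u -> v != 0 -> 0 < (v *m metric f u *m v^T) 0 0.
Proof.
move=> Uu v0; rewrite metric_dot// lt_def dot_ge0 andbT.
by apply: contraNneq v0 => /dot_eq0/(inj Uu) ->.
Qed.

Lemma metric_unit u : U u -> metric f u \in unitmx.
Proof.
move=> Uu; rewrite -row_free_unit; apply: inj_row_free => v vg.
apply: (inj Uu); apply: dot_eq0; rewrite -metric_dot// vg mul0mx mxE//.
Qed.

Lemma smooth_frame_exists :
  exists2 e : 'rV[R]_n -> 'M[R]_n, mx_smooth U e &
    forall u, U u -> e u *m metric f u *m (e u)^T = 1%:M.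
Proof.
apply: smooth_cholesky => //; [exact: metric_smooth|by move=> u _; exact:
  metric_sym|].
by move=> u Uu v; exact: metric_pos.
Qed.

Lemma frame_inv u (e : 'M[R]_n) : U u ->
  e *m metric f u *m e^T = 1%:M -> invmx (metric f u) = e^T *m e.
Proof.
move=> Uu H; have g := metric_unit Uu.
have : (e^T *m e) *m metric f u = 1%:M.
  by rewrite -mulmxA; apply: mulmx1C; exact: H.
by move=> /(congr1 (mulmx^~ (invmx (metric f u)))); rewrite mulmxK// mul1mx.
Qed.

(** No determinant is needed: the inverse metric is [e^T e] for a smooth
    orthonormal frame [e]. *)
Lemma metric_inv_smooth : mx_smooth U (fun u => invmx (metric f u)).
Proof.
have [e se He] := smooth_frame_exists.
apply: (@mx_smooth_ext _ _ _ Uopen _ _ (fun u => (e u)^T *m e u)).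
  by move=> u Uu; rewrite (@frame_inv _ (e u))//; exact: He.
by apply: mx_smooth_mul => //; exact: mx_smooth_tr.
Qed.

Lemma mx_smooth_on (X : 'rV[R]_n -> 'rV[R]_n) : mx_smooth U X -> smooth_on U X.
Proof. by move=> s; apply/smooth_onP => // j; exact: s. Qed.

Lemma derive_metric u v i j : U u ->
  'D_v (fun w => metric f w i j) u =
  dot ('D_v (d i) u) (d j u) + dot (d i u) ('D_v (d j) u).
Proof.
move=> Uu; rewrite -derive_dot; [|exact: partial_diff..].
by congr ('D_v _ u); apply/funext => w; rewrite mxE.
Qed.

(** Koszul's formula: writing [B a b c] for the product of the second derivative
    [d_a d_b f] with [d_c f], each derivative of the metric is a sum of two such
    terms, and by Schwarz all cancel except twice [B i j l]. *)
Lemma christoffelE u k i j : U u -> christoffel f k i j u =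
  \sum_l invmx (metric f u) k l * dot ('D_(delta_mx 0 i) (d j) u) (d l u).
Proof.
move=> Uu; rewrite /christoffel mulr_sumr; apply: eq_bigr => l _.
pose B a b c := dot ('D_(delta_mx 0 a) (d b) u) (d c u).
have E a b c : 'D_(delta_mx 0 a) (fun w => metric f w b c) u =
  B a b c + B a c b.
  exact: etrans (derive_metric _ _ _ Uu) (congr1 (+%R _) (dotC _ _)).
have BS a b c : B a b c = B b a c.
  have X := schwarz_vec (delta_mx 0 a) (delta_mx 0 b) Uopen sf Uu.
  have Y := congr1 (fun x => dot x (d c u)) X.
 exact Y.
rewrite (E i j l) (E j i l) (E l i j) -/(B i j l) (BS j i l) (BS l i j)
  (BS l j i).
by move: (B i j l) (B i l j) (B j l i) => x y z; field.
Qed.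

Lemma christoffel_smooth k i j : scalar_smooth U (christoffel f k i j).
Proof.
apply: (@scalar_smooth_ext _ _ _ Uopen (fun u => \sum_l invmx (metric f u) k l *
  dot ('D_(delta_mx 0 i) (d j) u) (d l u))).
  by move=> u Uu; rewrite christoffelE.
apply: scalar_smooth_sum => // l _; apply: scalar_smooth_mul => //;
  first exact: metric_inv_smooth.
by apply: scalar_smooth_dot => //; [apply: smooth_D|]; exact: partial_smooth.
Qed.

Lemma christoffel_dot u i j l : U u ->
  dot (\sum_k christoffel f k i j u *: d k u) (d l u) =
  dot ('D_(delta_mx 0 i) (d j) u) (d l u).
Proof.
move=> Uu; pose b := \col_l dot ('D_(delta_mx 0 i) (d j) u) (d l u).
transitivity ((metric f u *m (invmx (metric f u) *m b)) l 0).
  rewrite mxE dot_suml; apply: eq_bigr => k _.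
  rewrite dotZl christoffelE// [LHS]mulrC; congr (_ * _).
    by apply: esym; rewrite mxE; exact: dotC.
  by rewrite [RHS]mxE; apply: eq_bigr => l' _; rewrite [in RHS]mxE.
by rewrite mulKVmx ?metric_unit// mxE.
Qed.

(** The value of the second fundamental form on two coordinate fields. *)
Definition coord_sff i j u : 'rV[R]_N :=
  'D_(delta_mx 0 i) (d j) u - \sum_k christoffel f k i j u *: d k u.

Lemma coord_sff_sym i j u : U u -> coord_sff i j u = coord_sff j i u.
Proof.
move=> Uu.
have S := schwarz_vec (delta_mx 0 i) (delta_mx 0 j) Uopen sf Uu.
apply: (congr2 (fun x y => x - y) S).
apply: eq_bigr => q _; apply: (congr1 ( *:%R^~ (d q u))).
rewrite (christoffelE _ _ _ Uu) (christoffelE _ _ _ Uu).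
apply: eq_bigr => p _; apply: (congr1 ( *%R _)).
exact: (congr1 (fun x => dot x (d p u)) S).
Qed.

Lemma coord_sff_smooth i j : smooth_on U (coord_sff i j).
Proof.
apply: smooth_sub => //; first by apply: smooth_D; exact: partial_smooth.
apply: smooth_sum => // k; apply: smooth_scale => //; first exact:
  christoffel_smooth.
exact: partial_smooth.
Qed.

(** The Christoffel symbols are exactly the coefficients of the tangential part
    of [d_i d_j f], by [christoffel_dot]. *)
Lemma coord_sff_normal i j u l : U u -> dot (coord_sff i j u) (d l u) = 0.
Proof. by move=> Uu; rewrite dotBl christoffel_dot// subrr. Qed.

Lemma normal_dir u v (w : 'rV[R]_N) : U u ->
  (forall l, dot w (d l u) = 0) -> dot w ('D_v f u) = 0.
Proof.
move=> Uu H; rewrite (derive_dir v (immersion_diff Uu)) dot_sumr big1// => j _.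
by rewrite dotZr H mulr0.
Qed.

Lemma derive_push u (Y : 'rV[R]_n -> 'rV[R]_n) v : U u -> differentiable Y u ->
  'D_v (push f Y) u = 'D_('D_v Y u) f u +
    \sum_j Y u 0 j *: 'D_v (d j) u.
Proof.
move=> Uu dY.
have dYj j : differentiable (fun w => Y w 0 j) u.
  by move/differentiable_coordP: dY; exact.
have E : \near u, (fun w => \sum_j Y w 0 j *: d j w) u = push f Y u.
  apply: open_near_eq Uu => // w Uw; rewrite /push.
  by rewrite (derive_dir (Y w) (immersion_diff Uw)).
apply: etrans (esym (near_eq_derive v E)) _.
have H j := @derive_scale _ _ _ (fun w => Y w 0 j) (d j) u v (dYj j)
  (partial_diff j Uu).
have [_ ->] := @derive_sum_fun _ _ _ _ (fun j w => Y w 0 j *: d j w) u v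
  (fun j => proj1 (H j)).
rewrite (derive_dir ('D_v Y u) (immersion_diff Uu)) -big_split; apply:
  eq_bigr => j _.
by rewrite (proj2 (H j)) derive_coord.
Qed.

(** The second fundamental form is tensorial: the terms that differentiate [Y]
    cancel between [D_X Y] and [nabla_X Y]. *)
Lemma second_ffE X Y u : U u -> differentiable Y u ->
  second_ff f X Y u = \sum_i \sum_j (X u 0 i * Y u 0 j) *: coord_sff i j u.
Proof.
move=> Uu dY; rewrite /second_ff /Dconn derive_push// /push /nabla.
rewrite (derive_dirD _ _ (immersion_diff Uu)) opprD addrACA subrr add0r.
rewrite [X in _ - X](derive_dir _ (immersion_diff Uu)).
under [in RHS]eq_bigr do under eq_bigr do rewrite scalerBr.
under [in RHS]eq_bigr do rewrite sumrB.
rewrite sumrB; congr (_ - _).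
  rewrite exchange_big/=; apply: eq_bigr => j _.
  rewrite (derive_dir (X u) (partial_diff j Uu)) scaler_sumr; apply:
    eq_bigr => i _.
  by rewrite scalerA mulrC.
under [in RHS]eq_bigr do under eq_bigr do rewrite scaler_sumr.
under [in RHS]eq_bigr do rewrite exchange_big/=.
rewrite [RHS]exchange_big/=; apply: eq_bigr => k _.
rewrite mxE scaler_suml; apply: eq_bigr => i _.
rewrite scaler_suml; apply: eq_bigr => j _.
by rewrite scalerA; congr (_ *: _); ring.
Qed.

(** The trace of the second fundamental form with respect to the metric, which
    needs no frame. *)
Definition coord_mean u : 'rV[R]_N :=
  n%:R^-1 *: \sum_i \sum_j invmx (metric f u) i j *: coord_sff i j u.

Lemma coord_mean_smooth : smooth_on U coord_mean.
Proof.
apply: smooth_scale => //; first exact: scalar_smooth_cst.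
apply: smooth_sum => // i; apply: smooth_sum => // j; apply: smooth_scale => //.
  exact: metric_inv_smooth.
exact: coord_sff_smooth.
Qed.

Lemma coord_mean_normal u l : U u -> dot (coord_mean u) (d l u) = 0.
Proof.
move=> Uu; rewrite dotZl dot_suml big1 ?mulr0// => i _.
rewrite dot_suml big1// => j _; by rewrite dotZl coord_sff_normal// mulr0.
Qed.

Definition frame_mx (e : 'I_n -> 'rV[R]_n -> 'rV[R]_n) u : 'M[R]_n :=
  \matrix_(i, j) e i u 0 j.

Lemma frame_mxP (V : set 'rV[R]_n) e u : V `<=` U -> V u ->
  orthonormal_frame f V e ->
  frame_mx e u *m metric f u *m (frame_mx e u)^T = 1%:M.
Proof.
move=> VU Vu [_ He]; apply/matrixP => i j; rewrite [RHS]mxE -(He u Vu i j).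
have rE k : row k (frame_mx e u) = e k u by apply/rowP => l; rewrite !mxE.
by rewrite /push -metric_dot; [rewrite -!rE -row_mul !mxE;
  apply: eq_bigr => k _; rewrite !mxE|exact: VU].
Qed.

(** In an orthonormal frame with matrix [e] the inverse metric is [e^T e], so
    the trace over the frame is the trace over the metric. *)
Lemma mean_curvatureE (V : set 'rV[R]_n) e u : open V -> V `<=` U -> V u ->
  orthonormal_frame f V e -> mean_curvature f e u = coord_mean u.
Proof.
move=> Vo VU Vu fe; have Uu := VU u Vu; have [se _] := fe.
rewrite /mean_curvature /coord_mean (frame_inv Uu (frame_mxP VU Vu fe));
  congr (_ *: _).
under eq_bigr do rewrite (second_ffE _ Uu (smooth_diff (se _) Vu)).
rewrite exchange_big/=; apply: eq_bigr => i _.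
rewrite exchange_big/=; apply: eq_bigr => j _.
rewrite -scaler_suml mxE; congr (_ *: _); apply: eq_bigr => k _.
by rewrite !mxE.
Qed.

Lemma tangent_partP u (w : 'rV[R]_N) l : U u ->
  dot ('D_(tangent_part f u w) f u) (d l u) = dot w (d l u).
Proof.
move=> Uu; rewrite -metric_dot// /tangent_part mulmxKV ?metric_unit//.
by rewrite trmx_delta -colE !mxE.
Qed.

Lemma normal_partP u (w : 'rV[R]_N) l : U u ->
  dot (normal_part f u w) (d l u) = 0.
Proof. by move=> Uu; rewrite dotBl tangent_partP// subrr. Qed.

Lemma normal_part_smooth (W : 'rV[R]_n -> 'rV[R]_N) : smooth_on U W ->
  smooth_on U (fun u => normal_part f u (W u)).
Proof.
move=> sW; apply: smooth_sub => //.
apply: smooth_Ddir => //; apply: mx_smooth_on.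
apply: mx_smooth_mul => //; last exact: metric_inv_smooth.
move=> i j; apply: (@scalar_smooth_ext _ _ _ Uopen
  (fun u => dot (W u) (d j u))).
  by move=> u _; rewrite mxE.
by apply: scalar_smooth_dot => //; exact: partial_smooth.
Qed.

End geometry.

(** * The Bochner inequality and the estimate at a maximum *)

(** The computation at a maximum, as a statement on numbers: [p] is [r - |x|^2],
    [q] is [|x|^2], [rh] is [|H|^2], [h] is [<x, H>], [S] is the sum of the
    squares of the frame derivatives of [p], and [L], [Lp], [Lpp], [FL] are the
    Laplacians of [|H|^2], [p], [p^2] and [p^2 |H|^2], with [X] the mixed sum of
    the Leibniz rule for [p^2 |H|^2]. The square [|p H - 2 x|^2 >= 0] absorbs
    the term in [h]. *)
Lemma max_estimate_arith (R : realFieldType)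
  (nn r p q rh h S L FL Lpp Lp X S' : R) :
  1 <= nn -> 0 < p -> 0 < rh -> p = r - q -> 0 <= q ->
  0 <= p ^+ 2 * rh - 4 * (p * h) + 4 * q ->
  2 * nn * rh ^+ 2 <= L -> S <= 4 * nn * q ->
  FL = Lpp * rh + p * p * L + 2 * X ->
  Lpp = Lp * p + p * Lp + 2 * S' ->
  X = - (4 * rh) * S -> S' = S -> Lp = - (2 * nn * (1 + h)) ->
  FL <= 0 -> p ^+ 2 * rh <= 28 * r.
Proof.
move=> nn1 p0 rp pE q0 cs B HS -> -> -> -> -> Fl.
have nn0 : 0 < nn by apply: lt_le_trans nn1.
have Bp : p * p * (2 * nn * rh ^+ 2) <= p * p * L.
  by rewrite ler_pM2l// mulr_gt0.
have step : rh * (2 * nn * (p ^+ 2 * rh)) <=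
  rh * (4 * nn * (p * (1 + h)) + 6 * S).
  set A := p * p * L in Bp Fl; lra.
rewrite (ler_pM2l rp) in step.
suff : nn * (p ^+ 2 * rh) <= nn * (28 * r) by rewrite (ler_pM2l nn0).
have c1 : 0 <= nn * (p ^+ 2 * rh - 4 * (p * h) + 4 * q) by rewrite mulr_ge0//
  ltW.
have c2 : 0 <= nn * p by rewrite mulr_ge0// ltW.
have rE : r = p + q by rewrite pE subrK.
rewrite rE; lra.
Qed.

Section bochner.
Variables (R : realType) (n N : nat) (f : 'rV[R]_n -> 'rV[R]_N) (U :
  set 'rV[R]_n).
Hypothesis Uopen : open U.
Hypothesis sf : smooth_on U f.
Hypothesis inj : forall u, U u -> forall v, 'D_v f u = 0 -> v = 0.
Hypothesis n0 : (0 < n)%N.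
Variable e : 'I_n -> 'rV[R]_n -> 'rV[R]_n.
Hypothesis fe : orthonormal_frame f U e.
Implicit Types (u v w : 'rV[R]_n).

Let H := mean_curvature f e.
Let E i := push f (e i).
Let Z i := nabla f (e i) (e i).

Definition frameD i (phi : 'rV[R]_n -> R) w := 'D_(e i w) phi w.

(** The Laplacian of functions of the induced metric, written in the frame. *)
Definition lap (phi : 'rV[R]_n -> R) u :=
  \sum_i (frameD i (frameD i phi) u - 'D_(Z i u) phi u).

Lemma frame_smooth i : smooth_on U (e i).
Proof. by have [s _] := fe; exact: s. Qed.

Lemma frame_mean_curvatureE u : U u -> H u = coord_mean f u.
Proof.
by move=> Uu; exact: (mean_curvatureE Uopen sf inj Uopen (@subset_refl _ U) Uu
  fe).
Qed.

Lemma mean_curvature_smooth : smooth_on U H.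
Proof.
apply: (@smooth_ext _ _ _ Uopen _ (coord_mean f)); last exact:
  coord_mean_smooth.
by move=> u Uu; rewrite frame_mean_curvatureE.
Qed.

Lemma push_frame_smooth i : smooth_on U (E i).
Proof. by apply: smooth_Ddir => //; exact: frame_smooth. Qed.

Lemma frameD_smooth i phi : scalar_smooth U phi ->
  scalar_smooth U (frameD i phi).
Proof. by apply: scalar_smooth_Ddir => //; exact: frame_smooth. Qed.

Lemma mean_curvature_normal u v : U u -> dot (H u) ('D_v f u) = 0.
Proof.
move=> Uu; apply: (normal_dir sf _ Uu) => l.
by rewrite frame_mean_curvatureE//; exact: (coord_mean_normal Uopen sf inj).
Qed.

(** The same operator applied to the immersion gives [n H]; here it is just the
    definition of [H], the case [n = 0] being excluded. *)
Lemma sum_second_ff u : \sum_i second_ff f (e i) (e i) u = n%:R *: H u.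
Proof.
by rewrite /H /mean_curvature scalerA mulfV ?scale1r// pnatr_eq0 -lt0n.
Qed.

Lemma dot_normal_part u (w : 'rV[R]_N) : U u ->
  dot (normal_part f u w) (H u) = dot w (H u).
Proof.
by move=> Uu; rewrite dotBl (dotC ('D__ f u)) mean_curvature_normal// subr0.
Qed.

Lemma normal_part_dot u (w : 'rV[R]_N) v : U u ->
  dot (normal_part f u w) ('D_v f u) = 0.
Proof.
by move=> Uu; apply: (normal_dir sf _ Uu) => l; exact: (normal_partP sf inj).
Qed.

Lemma dot_tangent_part u (w : 'rV[R]_N) v : U u ->
  dot ('D_(tangent_part f u w) f u) ('D_v f u) = dot w ('D_v f u).
Proof.
move=> Uu; have := normal_part_dot w v Uu.
by rewrite dotBl => /eqP; rewrite subr_eq0 => /eqP.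
Qed.

Lemma nabla_perp_mean_smooth i : smooth_on U (nabla_perp f (e i) H).
Proof.
apply: normal_part_smooth => //; apply: smooth_Ddir => //; first exact:
  frame_smooth.
exact: mean_curvature_smooth.
Qed.

Lemma derive_mean_sqr u v : U u ->
  'D_v (fun w => dot (H w) (H w)) u =
    2 * dot (normal_part f u ('D_v H u)) (H u).
Proof.
move=> Uu; have dH := smooth_diff mean_curvature_smooth Uu.
by rewrite derive_dot// dot_normal_part// (dotC (H u)) mulrDl mul1r.
Qed.

(** Since [H] is normal, [D_X H] may be replaced by its normal part in [<D_X H,
    H>]; differentiating once more, the same replacement gives the normal
    Laplacian and the square of the normal derivative. *)
Lemma lap_mean_sqr u : U u -> lap (fun w => dot (H w) (H w)) u =
  2 * dot (normal_laplacian f e H u) (H u) +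
  2 * \sum_i dot (nabla_perp f (e i) H u) (nabla_perp f (e i) H u).
Proof.
move=> Uu; rewrite /lap /normal_laplacian dot_suml !mulr_sumr -big_split.
apply: eq_bigr => i _.
set P := nabla_perp f (e i) H.
have dP := smooth_diff (nabla_perp_mean_smooth i) Uu.
have dH := smooth_diff mean_curvature_smooth Uu.
have near_eq : \near u, (fun w => 2 * dot (P w) (H w)) u =
    frameD i (fun w => dot (H w) (H w)) u.
  by apply: (open_near_eq Uopen _ Uu) => w Uw; rewrite /frameD derive_mean_sqr.
have -> : frameD i (frameD i (fun w => dot (H w) (H w))) u =
    2 * (dot ('D_(e i u) P u) (H u) + dot (P u) ('D_(e i u) H u)).
  apply: etrans (esym (near_eq_derive (e i u) near_eq)) _.
  rewrite -(derive_dot _ dP dH) derive_mul.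
  - by rewrite derive_cst mul0r add0r.
  - exact: differentiable_cst.
  - exact: scalar_smooth_diff (scalar_smooth_dot Uopen
    (nabla_perp_mean_smooth i) mean_curvature_smooth) Uu.
have e1 : dot (P u) ('D_(e i u) H u) = dot (P u) (P u).
  have e2 : P u = 'D_(e i u) H u - 'D_(tangent_part f u ('D_(e i u) H u)) f u
    by [].
  have e3 : dot (P u) ('D_(tangent_part f u ('D_(e i u) H u)) f u) = 0.
    exact: normal_part_dot.
  by rewrite [X in _ = dot _ X]e2 dotBr e3 subr0.
have e4 : dot (nabla_perp f (e i) P u) (H u) = dot ('D_(e i u) P u) (H u).
  exact: dot_normal_part.
have e5 : 'D_(Z i u) (fun w => dot (H w) (H w)) u =
  2 * dot (nabla_perp f (Z i) H u) (H u).
  exact: derive_mean_sqr.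
have e6 := etrans (dotBl (nabla_perp f (e i) P u) (nabla_perp f (Z i) H u)
  (H u))
  (congr1 (fun x => x - _) e4).
have alg (a1 a2 a3 a4 a5 b : R) : a2 = a5 -> a3 = 2 * b -> a4 = a1 - b ->
    2 * (a1 + a2) - a3 = 2 * a4 + 2 * a5 by move=> -> -> ->; ring.
exact: alg e1 e5 e6.
Qed.

Lemma frame_expand u v : U u ->
  v = \sum_j dot ('D_v f u) (E j u) *: e j u.
Proof.
move=> Uu.
have A := frame_mxP sf (@subset_refl _ U) Uu fe.
have B : metric f u *m ((frame_mx e u)^T *m frame_mx e u) = 1%:M.
  by rewrite mulmxA; apply: mulmx1C; rewrite mulmxA.
rewrite -[LHS]mulmx1 -B !mulmxA.
rewrite mulmx_sum_row; apply: eq_bigr => j _.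
have rE k : row k (frame_mx e u) = e k u by apply/rowP => l; rewrite !mxE.
rewrite rE; congr (_ *: _).
rewrite /E /push -(metric_dot sf _ _ Uu) -rE [LHS]mxE [RHS]mxE; apply:
  eq_bigr => k _.
by rewrite !mxE.
Qed.

Let a i j u := dot (second_ff f (e i) (e j) u) (H u).

(** Differentiate [<E_i, H> = 0] in the direction [X]. *)
Lemma second_ff_mean X i u : U u ->
  dot (second_ff f X (e i) u) (H u) = - dot (E i u) ('D_(X u) H u).
Proof.
move=> Uu; have dH := smooth_diff mean_curvature_smooth Uu.
have dE := smooth_diff (push_frame_smooth i) Uu.
apply: etrans (dotBl _ _ _) _.
have e1 : dot (push f (nabla f X (e i)) u) (H u) = 0.
  exact: etrans (dotC _ _) (mean_curvature_normal _ Uu).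
apply: etrans (congr1 (fun x => _ - x) e1) _; rewrite subr0.
apply/eqP; rewrite -subr_eq0 opprK; apply/eqP.
rewrite -derive_dot//.
have near_eq : \near u, (fun=> 0 : R) u = (fun w => dot (E i w) (H w)) u.
  apply: (open_near_eq Uopen _ Uu) => w Uw.
  exact: esym (etrans (dotC _ _) (mean_curvature_normal _ Uw)).
by rewrite -(near_eq_derive (X u) near_eq) derive_cst.
Qed.

Lemma sff_coeff_sym i j u : U u -> a i j u = a j i u.
Proof.
move=> Uu; have de k := smooth_diff (frame_smooth k) Uu.
rewrite /a !(second_ffE Uopen sf _ Uu (de _)).
congr dot; rewrite exchange_big/=; apply: eq_bigr => k _; apply: eq_bigr => l _.
exact: (congr2 *:%R (mulrC _ _) (coord_sff_sym Uopen sf _ _ Uu)).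
Qed.

(** The matrix of [A_H] in the frame is that of the second fundamental form
    paired with [H]. *)
Lemma weingarten_expand i u : U u ->
  weingarten f H (e i) u = \sum_j a i j u *: e j u.
Proof.
move=> Uu; rewrite [LHS](frame_expand _ Uu); apply: eq_bigr => j _.
congr (_ *: _); have fd := immersion_diff sf Uu.
have -> : 'D_(weingarten f H (e i) u) f u =
    - 'D_(tangent_part f u (Dconn (e i) H u)) f u.
  by rewrite /weingarten -scaleN1r derive_dirZ// scaleN1r.
apply: etrans (dotNl _ _) _.
apply: etrans (congr1 -%R (dot_tangent_part _ (e j u) Uu)) _.
apply: etrans (congr1 -%R (dotC _ _)) _.
exact: esym (second_ff_mean (e i) j Uu).
Qed.

(** The trace of [A_H^2], which is the squared norm of [A_H] because [A_H] is
    symmetric. *)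
Lemma weingarten_trace u : U u ->
  dot (\sum_i second_ff f (weingarten f H (e i)) (e i) u) (H u) =
  \sum_i \sum_j a i j u ^+ 2.
Proof.
move=> Uu; rewrite dot_suml; apply: eq_bigr => i _.
rewrite second_ff_mean// weingarten_expand//.
have dH := smooth_diff mean_curvature_smooth Uu.
rewrite (derive_dir_sum _ _ dH) dot_sumr -sumrN; apply: eq_bigr => j _.
apply: etrans (congr1 -%R (dotZr _ _ _)) _; rewrite -mulrN expr2.
apply: (congr1 ( *%R _)); apply: etrans (esym (second_ff_mean (e j) i Uu)) _.
exact: sff_coeff_sym.
Qed.

Lemma sqr_sum_le (x : 'I_n -> R) :
  (\sum_i x i) ^+ 2 <= n%:R * \sum_i x i ^+ 2.
Proof.
have := cauchy_schwarz (\row_i x i) (\row_i 1 : 'rV[R]_n).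
rewrite /dot; under eq_bigr do rewrite !mxE mulr1.
under [X in _ <= X * _]eq_bigr do rewrite !mxE -expr2.
under [X in _ <= _ * X]eq_bigr do rewrite !mxE mulr1.
by rewrite sumr_const card_ord mulrC.
Qed.

(** Drop the off-diagonal terms and apply Cauchy-Schwarz to the diagonal, whose
    sum is [<H, n H>]. *)
Lemma trace_ineq u : U u ->
  n%:R * dot (H u) (H u) ^+ 2 <= \sum_i \sum_j a i j u ^+ 2.
Proof.
move=> Uu; set rho := dot (H u) (H u).
have n1 : 0 < n%:R :> R by rewrite ltr0n.
have T : \sum_i a i i u = n%:R * rho.
  by rewrite /a -dot_suml sum_second_ff dotZl.
have := sqr_sum_le (fun i => a i i u); rewrite T exprMn => h.
have {}h : n%:R * rho ^+ 2 <= \sum_i a i i u ^+ 2.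
  by rewrite -(ler_pM2l n1) mulrA -expr2.
apply: le_trans h _; apply: ler_sum => i _.
by rewrite (bigD1 i)//= lerDl sumr_ge0// => j _; rewrite sqr_ge0.
Qed.

Variable lambda : R.
Hypothesis l0 : 0 <= lambda.
Hypothesis bim : forall u, U u ->
  normal_laplacian f e H u
      - \sum_(i < n) second_ff f (weingarten f H (e i)) (e i) u
    = lambda *: H u.

(** The only place where the biminimal equation and the sign of [lambda] enter.
*)
Lemma bochner u : U u ->
  2 * n%:R * dot (H u) (H u) ^+ 2 <= lap (fun w => dot (H w) (H w)) u.
Proof.
move=> Uu; have e0 : normal_laplacian f e H u = lambda *: H u +
    \sum_(i < n) second_ff f (weingarten f H (e i)) (e i) u.
  by rewrite -bim// subrK.
have e1 := etrans (congr1 (fun x => dot x (H u)) e0) (etrans (dotDl _ _ _)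
  (congr2 +%R (dotZl _ _ _) (weingarten_trace Uu))).
have h1 := trace_ineq Uu.
have h2 : 0 <= lambda * dot (H u) (H u) by rewrite mulr_ge0// dot_ge0.
have h3 : 0 <= \sum_i dot (nabla_perp f (e i) H u) (nabla_perp f (e i) H u).
  by apply: sumr_ge0 => i _; exact: dot_ge0.
have alg (L D S T l q nn : R) : L = 2 * D + 2 * S -> D = l + T ->
   nn * q <= T -> 0 <= l -> 0 <= S -> 2 * nn * q <= L.
  by move=> -> -> p1 p2 p3; lra.
exact: alg (lap_mean_sqr Uu) e1 h1 h2 h3.
Qed.

Lemma frameD_mul i phi psi u : scalar_smooth U phi -> scalar_smooth U psi ->
  U u ->
  frameD i (fun w => phi w * psi w) u =
  frameD i phi u * psi u + phi u * frameD i psi u.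
Proof.
by move=> s t Uu; apply: derive_mul;
  [exact: scalar_smooth_diff s Uu|exact: scalar_smooth_diff t Uu].
Qed.

Lemma lap_mul phi psi u : scalar_smooth U phi -> scalar_smooth U psi -> U u ->
  lap (fun w => phi w * psi w) u =
  lap phi u * psi u + phi u * lap psi u +
  2 * \sum_i frameD i phi u * frameD i psi u.
Proof.
move=> s t Uu; rewrite /lap mulr_sumr mulr_suml mulr_sumr -!big_split.
apply: eq_bigr => i _ /=.
have ds := scalar_smooth_diff s Uu; have dt := scalar_smooth_diff t Uu.
have near_eq : \near u,
   (fun w => frameD i phi w * psi w + phi w * frameD i psi w) u
   = frameD i (fun w => phi w * psi w) u.
  by apply: (open_near_eq Uopen _ Uu) => w Uw; rewrite frameD_mul.
have si := frameD_smooth i s; have ti := frameD_smooth i t.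
have -> : frameD i (frameD i (fun w => phi w * psi w)) u =
   frameD i (frameD i phi) u * psi u + frameD i phi u * frameD i psi u
   + (frameD i phi u * frameD i psi u + phi u * frameD i (frameD i psi) u).
  apply: etrans (esym (near_eq_derive (e i u) near_eq)) _.
  rewrite -(frameD_mul i si t Uu) -(frameD_mul i s ti Uu).
  apply: deriveD; apply: diff_derivable.
  - exact: scalar_smooth_diff (scalar_smooth_mul Uopen si t) Uu.
  - exact: scalar_smooth_diff (scalar_smooth_mul Uopen s ti) Uu.
rewrite (derive_mul _ ds dt).
move: (frameD i (frameD i phi) u) (frameD i (frameD i psi) u) => x y.
move: (frameD i phi u) (frameD i psi u) ('D_(Z i u) phi u) ('D_(Z i u) psi u).
by move=> p q z t'; ring.
Qed.

(** At a critical point [e_i e_i phi] is the second derivative of [phi] in the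
    fixed direction [e_i u], because the derivative of the frame is paired with
    the vanishing gradient. *)
Lemma lap_local_max phi u : scalar_smooth U phi -> U u ->
  (\forall x \near u, phi x <= phi u) ->
  (forall i, frameD i phi u = 0) /\ lap phi u <= 0.
Proof.
move=> s Uu mx; have crit v := local_max_critical Uopen v s Uu mx.
split=> [i|]; first exact: crit.
apply: sumr_le0 => i _; rewrite crit subr0.
have D : frameD i (frameD i phi) u = 'D_(e i u) ('D_(e i u) phi) u.
  have de := smooth_diff (frame_smooth i) Uu.
  have near_eq : \near u,
      (fun w => \sum_j e i w 0 j * 'D_(delta_mx 0 j) phi w) u = frameD i phi u.
    apply: (open_near_eq Uopen _ Uu) => w Uw; rewrite /frameD.
    by rewrite (derive_dir (e i w) (scalar_smooth_diff s Uw)).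
  have near_eq' : \forall x \near u,
      (fun w => \sum_j e i u 0 j * 'D_(delta_mx 0 j) phi w) x =
        'D_(e i u) phi x.
    apply: (open_near_eq Uopen _ Uu) => w Uw.
    by rewrite (derive_dir (e i u) (scalar_smooth_diff s Uw)).
  have dj j : differentiable ('D_(delta_mx 0 j) phi) u by exact:
    scalar_smooth_diff (scalar_smooth_D _ s) Uu.
  have dej j : differentiable (fun w => e i w 0 j) u.
    by move/differentiable_coordP: de; exact.
  apply: etrans (esym (near_eq_derive (e i u) near_eq)) _.
  apply: etrans _ (near_eq_derive (e i u) near_eq').
  have [_ ->] := @derive_sum_fun _ _ _ _
    (fun j w => e i w 0 j * 'D_(delta_mx 0 j) phi w) u (e i u)
    (fun j => differentiableM (dej j) (dj j)).
  have [_ ->] := @derive_sum_fun _ _ _ _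
    (fun j w => e i u 0 j * 'D_(delta_mx 0 j) phi w) u (e i u)
    (fun j => differentiableM (differentiable_cst _ _) (dj j)).
  apply: eq_bigr => j _.
  rewrite (derive_mul _ (dej j) (dj j)) crit mulr0 add0r.
  by rewrite (derive_mul _ (differentiable_cst _ _) (dj j)) derive_cst mul0r
    add0r.
rewrite D; exact: (local_max_second Uopen _ s Uu mx).
Qed.

Variable r : R.
Let phi w := r - dot (f w) (f w).

Lemma dist_gap_smooth : scalar_smooth U phi.
Proof.
by apply: scalar_smooth_sub => //;
  [exact: scalar_smooth_cst|exact: scalar_smooth_dot].
Qed.

Lemma derive_dist_gap u v : U u -> 'D_v phi u = - (2 * dot ('D_v f u) (f u)).
Proof.
move=> Uu; have fd := immersion_diff sf Uu.
have s : scalar_smooth U (fun w => dot (f w) (f w)) by exact: scalar_smooth_dot.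
rewrite [LHS](@deriveB _ _ _ (cst r)); last 2 first.
- exact: derivable_cst.
- exact: scalar_smooth_derivable s Uu.
rewrite derive_cst sub0r; congr (- _).
by rewrite (derive_dot _ fd fd) (dotC (f u)) mulrDl mul1r.
Qed.

(** [lap |x|^2 = 2 <lap x, x> + 2 sum_i |E_i|^2], where [lap x = n H] and the
    [E_i] are unit vectors. *)
Lemma lap_dist_gap u : U u ->
  lap phi u = - (2 * n%:R * (1 + dot (f u) (H u))).
Proof.
move=> Uu; have fd := immersion_diff sf Uu.
have -> : 2 * n%:R * (1 + dot (f u) (H u)) =
   \sum_i (2 * (1 + dot (second_ff f (e i) (e i) u) (f u))).
  rewrite -mulr_sumr big_split/= sumr_const card_ord -dot_suml sum_second_ff.
  by rewrite dotZl (dotC (H u)); ring.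
rewrite /lap -sumrN; apply: eq_bigr => i _.
have dE := smooth_diff (push_frame_smooth i) Uu.
have near_eq : \near u, (fun w => (-2) * dot (E i w) (f w)) u = frameD i phi u.
  by apply: (open_near_eq Uopen _ Uu) => w Uw;
    rewrite /frameD derive_dist_gap// mulNr.
have -> : frameD i (frameD i phi) u =
    (-2) * (dot ('D_(e i u) (E i) u) (f u) + dot (E i u) (E i u)).
  apply: etrans (esym (near_eq_derive (e i u) near_eq)) _.
  rewrite derive_mul.
  - by rewrite derive_cst mul0r add0r (derive_dot _ dE fd).
  - exact: differentiable_cst.
  - exact: scalar_smooth_diff (scalar_smooth_dot Uopen (push_frame_smooth i)
    sf) Uu.
have e1 : dot (E i u) (E i u) = 1.
  by have [_ /(_ u Uu i i)] := fe; rewrite eqxx.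
have e2 : dot (second_ff f (e i) (e i) u) (f u) =
    dot ('D_(e i u) (E i) u) (f u) - dot ('D_(Z i u) f u) (f u).
  exact: dotBl.
have alg (x y z p q : R) : y = 1 -> p = - (2 * z) -> q = x - z ->
    (-2) * (x + y) - p = - (2 * (1 + q)) by move=> -> -> ->; ring.
exact: alg e1 (derive_dist_gap (Z i u) Uu) e2.
Qed.

Lemma frameD_dist_gap_sqr u : U u ->
  \sum_i frameD i phi u ^+ 2 <= 4 * n%:R * dot (f u) (f u).
Proof.
move=> Uu; have -> : 4 * n%:R * dot (f u) (f u) =
  \sum_(i < n) 4 * dot (f u) (f u).
  by rewrite sumr_const card_ord -mulr_natr; ring.
apply: ler_sum => i _; rewrite /frameD derive_dist_gap// sqrrN exprMn.
have -> : 2 ^+ 2 = 4 :> R by ring.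
rewrite ler_pM2l//; have := cauchy_schwarz (E i u) (f u).
have -> : dot (E i u) (E i u) = 1.
  by have [_ /(_ u Uu i i)] := fe; rewrite eqxx.
by rewrite mul1r.
Qed.

(** At the maximum, [phi D_i rho = - 2 rho D_i phi] eliminates the derivatives
    of [rho = |H|^2] from [lap (phi^2 rho) <= 0]. *)
Lemma max_estimate u : U u -> 0 < phi u ->
  (\forall x \near u, phi x ^+ 2 * dot (H x) (H x) <=
    phi u ^+ 2 * dot (H u) (H u)) ->
  phi u ^+ 2 * dot (H u) (H u) <= 28 * r.
Proof.
move=> Uu p0 mx.
pose rho w := dot (H w) (H w).
have sr : scalar_smooth U rho by apply: scalar_smooth_dot => //; exact:
  mean_curvature_smooth.
have sp := dist_gap_smooth.
have spp : scalar_smooth U (fun w => phi w * phi w) by exact: scalar_smooth_mul.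
have [Fc Fl] := lap_local_max (scalar_smooth_mul Uopen spp sr) Uu mx.
have rge : r >= 0.
  by apply: le_trans (ltW p0) _; rewrite /phi lerBlDr lerDl dot_ge0.
have [r0|r0] := eqVneq (rho u) 0.
  by rewrite -/(rho u) r0 mulr0 mulr_ge0.
have rp : 0 < rho u by rewrite lt_def r0 dot_ge0.
have c i : phi u * frameD i rho u = - (2 * rho u * frameD i phi u).
  have := Fc i; rewrite frameD_mul// frameD_mul// => h.
  apply: (mulfI (lt0r_neq0 p0)); apply/eqP; rewrite -subr_eq0; apply/eqP.
  by rewrite -[RHS]h; ring.
have B : 2 * n%:R * rho u ^+ 2 <= lap rho u := bochner Uu.
have e1 := lap_mul spp sr Uu.
have e2 := lap_mul sp sp Uu.
have e3 : \sum_i frameD i (fun w => phi w * phi w) u * frameD i rho u =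
   - (4 * rho u) * \sum_i frameD i phi u ^+ 2.
  rewrite mulr_sumr; apply: eq_bigr => i _; rewrite (frameD_mul i sp sp Uu).
  move: (c i); move: (frameD i phi u) (frameD i rho u) (phi u) (rho u).
  move=> x y p q E'; transitivity (2 * x * (p * y)); first by ring.
  by rewrite E'; ring.
have e4 : \sum_i frameD i phi u * frameD i phi u = \sum_i frameD i phi u ^+ 2.
  by apply: eq_bigr => i _; exact: esym (expr2 _).
have S := frameD_dist_gap_sqr Uu.
have n1 : 1 <= n%:R :> R by rewrite ler1n.
have cs : 0 <= phi u ^+ 2 * rho u - 4 * (phi u * dot (f u) (H u)) + 4 * dot
  (f u) (f u).
  apply: le_trans (dot_ge0 (phi u *: H u - 2 *: f u)) _.
  rewrite /rho; move: (phi u) (H u) (f u) => p h x.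
  rewrite !(dotBl, dotBr, dotZl, dotZr) (dotC h x).
  by rewrite le_eqVlt; apply/orP; left; apply/eqP; ring.
have e5 : phi u = r - dot (f u) (f u) by [].
exact: max_estimate_arith n1 p0 rp e5 (dot_ge0 _) cs B S e1 e2 e3 e4
  (lap_dist_gap Uu) Fl.
Qed.

End bochner.

(** * Independence of the chart *)

(** Summation form of [tr (G (J h' J^T)) = tr ((J^T G J) h')]. *)
Lemma trace_congruence (R : realFieldType) (V : lmodType R) n
    (G J : 'M[R]_n) (h h' : 'I_n -> 'I_n -> V) :
  (forall i j, h i j = \sum_a \sum_b (J i a * J j b) *: h' a b) ->
  \sum_i \sum_j G i j *: h i j =
  \sum_a \sum_b (J^T *m G *m J) a b *: h' a b.
Proof.
move=> hE.
under eq_bigr do under eq_bigr do rewrite hE scaler_sumr.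
under eq_bigr do under eq_bigr do under eq_bigr do rewrite scaler_sumr.
under eq_bigr do rewrite exchange_big/=.
rewrite exchange_big/=; apply: eq_bigr => a _.
under eq_bigr do under eq_bigr do under eq_bigr do rewrite scalerA.
under eq_bigr do rewrite exchange_big/=.
rewrite exchange_big/=; apply: eq_bigr => b _.
under eq_bigr do rewrite -scaler_suml.
rewrite -scaler_suml; congr (_ *: _).
rewrite mxE exchange_big/=; apply: eq_bigr => j _.
rewrite mxE mulr_suml; apply: eq_bigr => i _.
by rewrite !mxE; ring.
Qed.

Lemma invmx_congruence (R : realFieldType) n (J g : 'M[R]_n) :
  J \in unitmx -> g \in unitmx -> invmx g = J^T *m invmx (J *m g *m J^T) *m J.
Proof.
move=> uJ ug; have uJT : J^T \in unitmx by rewrite unitmx_tr.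
set K := J *m g *m J^T.
have uK : K \in unitmx by rewrite !unitmx_mul uJ ug uJT.
have e : J *m g = K *m invmx J^T by rewrite /K mulmxK.
have : J^T *m invmx K *m J *m g = 1%:M.
  by rewrite -[LHS]mulmxA e mulmxA (mulmxKV uK) mulmxV.
by move=> /(congr1 (mulmx^~ (invmx g))); rewrite (mulmxK ug) mul1mx.
Qed.

Section invariance.
Variables (R : realType) (n N : nat).
Variables (f f' : 'rV[R]_n -> 'rV[R]_N) (U U' O : set 'rV[R]_n).
Variable t : 'rV[R]_n -> 'rV[R]_n.
Hypotheses (Uopen : open U) (U'open : open U') (Oopen : open O).
Hypotheses (sf : smooth_on U f) (sf' : smooth_on U' f') (st : smooth_on O t).
Hypothesis inj : forall u, U u -> forall v, 'D_v f u = 0 -> v = 0.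
Hypothesis inj' : forall u, U' u -> forall v, 'D_v f' u = 0 -> v = 0.
Hypothesis OU : O `<=` U.
Hypothesis tU : forall u, O u -> U' (t u).
Hypothesis ft : forall u, O u -> f' (t u) = f u.
Implicit Types (u v w : 'rV[R]_n).

Local Notation d i := ('D_(delta_mx 0 i) f).
Local Notation d' i := ('D_(delta_mx 0 i) f').

(** Row [i] is the derivative of the transition map [t] along the [i]-th
    coordinate, so that vectors, which are rows, are multiplied on the right. *)
Definition jac u : 'M[R]_n := \matrix_(i, a) ('D_(delta_mx 0 i) t u) 0 a.

Lemma derive_jac u v : O u -> 'D_v t u = v *m jac u.
Proof.
move=> Ou; rewrite (derive_dir v (smooth_diff st Ou)) mulmx_sum_row.
by apply: eq_bigr => i _; congr (_ *: _); apply/rowP => a; rewrite !mxE.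
Qed.

Lemma derive_transition u v : O u -> 'D_v f u = 'D_('D_v t u) f' (t u).
Proof.
move=> Ou; rewrite -derive_chain.
- by apply: near_eq_derive; apply: (open_near_eq Oopen _ Ou) => w Ow;
  rewrite ft.
- exact: smooth_diff st Ou.
- exact: smooth_diff sf' (tU Ou).
Qed.

Lemma metric_transition u : O u ->
  metric f u = jac u *m metric f' (t u) *m (jac u)^T.
Proof.
move=> Ou; apply/matrixP => i j.
have rj k : 'D_(delta_mx 0 k) t u = row k (jac u).
  by apply/rowP => a; rewrite !mxE.
rewrite mxE; apply: etrans (congr2 (@dot R N) (derive_transition _ Ou)
  (derive_transition _ Ou)) _.
rewrite -(metric_dot sf' _ _ (tU Ou)) !rj -row_mul !mxE.
by apply: eq_bigr => k _; rewrite !mxE.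
Qed.

Lemma jac_unit u : O u -> jac u \in unitmx.
Proof.
move=> Ou; have := metric_unit sf inj (OU Ou).
by rewrite metric_transition// !unitmx_mul => /andP[/andP[]].
Qed.

Lemma metric_inv_transition u : O u ->
  invmx (metric f' (t u)) = (jac u)^T *m invmx (metric f u) *m jac u.
Proof.
move=> Ou; rewrite (metric_transition Ou); apply: invmx_congruence.
  exact: jac_unit.
exact: (metric_unit sf' inj' (tU Ou)).
Qed.

Lemma derive_old u v : O u -> 'D_v f' (t u) = 'D_(v *m invmx (jac u)) f u.
Proof.
move=> Ou; apply: esym; apply: etrans (derive_transition _ Ou) _.
by rewrite (derive_jac _ Ou) (mulmxKV (jac_unit Ou)).
Qed.

(** The chain rule produces second derivatives of [t], but these come with first
    derivatives of [f'], which are orthogonal to [nu]. *)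
Lemma second_derive_transition u i j (nu : 'rV[R]_N) : O u ->
  (forall a, dot nu (d' a (t u)) = 0) ->
  dot ('D_(delta_mx 0 i) (d j) u) nu =
  \sum_a \sum_b jac u i a * jac u j b * dot ('D_(delta_mx 0 a) (d' b) (t u)) nu.
Proof.
move=> Ou nuN; pose X := 'D_(delta_mx 0 j) t.
have dX : differentiable X u by exact: smooth_diff (smooth_D _ st) Ou.
have dXb b : differentiable (fun w => X w 0 b) u.
  by move/differentiable_coordP: dX; exact.
have dt := smooth_diff st Ou.
have dd b : differentiable (d' b) (t u).
  exact: smooth_diff (smooth_D _ sf') (tU Ou).
have ddt b : differentiable (fun w => d' b (t w)) u.
  exact: (@differentiable_comp _ _ _ _ t (d' b)).
have E : \forall x \near u, (fun w => \sum_b X w 0 b *: d' b (t w)) x = d j x.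
  apply: (open_near_eq Oopen _ Ou) => w Ow.
  rewrite (derive_transition _ Ow).
  exact: esym (derive_dir _ (smooth_diff sf' (tU Ow))).
have H b := @derive_scale _ _ _ (fun w => X w 0 b) (fun w => d' b (t w)) u
  (delta_mx 0 i) (dXb b) (ddt b).
have [_ S] := @derive_sum_fun _ _ _ _ (fun b w => X w 0 b *: d' b (t w)) u
  (delta_mx 0 i) (fun b => proj1 (H b)).
apply: etrans (congr1 (fun y => dot y nu) (esym (near_eq_derive _ E))) _.
apply: etrans (congr1 (fun y => dot y nu) S) _.
apply: etrans (dot_suml _ _ _ _) _.
rewrite [RHS]exchange_big/=; apply: eq_bigr => b _.
apply: etrans (congr1 (fun y => dot y nu) (proj2 (H b))) _.
apply: etrans (dotDl _ _ _) _.
have z : dot (d' b (t u)) nu = 0 := etrans (dotC _ _) (nuN b).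
apply: etrans (congr2 +%R (etrans (dotZl _ _ _) (congr1 ( *%R _) z))
  (dotZl _ _ _)) _.
rewrite mulr0 add0r.
apply: etrans (congr1 (fun y => _ * dot y nu)
  (etrans (derive_chain _ dt (dd b)) (derive_dir _ (dd b)))) _.
apply: etrans (congr1 ( *%R _) (dot_suml _ _ _ _)) _.
rewrite mulr_sumr; apply: eq_bigr => a _.
apply: etrans (congr1 ( *%R _) (dotZl _ _ _)) _.
rewrite !mxE mulrCA mulrA //.
Qed.

Lemma coord_sff_dot (g : 'rV[R]_n -> 'rV[R]_N) u i j (nu : 'rV[R]_N) :
  (forall k, dot nu ('D_(delta_mx 0 k) g u) = 0) ->
  dot (coord_sff g i j u) nu = dot ('D_(delta_mx 0 i) ('D_(delta_mx 0 j) g) u)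
    nu.
Proof.
move=> H; apply: etrans (dotBl _ _ _) _.
have z : dot (\sum_k christoffel g k i j u *: 'D_(delta_mx 0 k) g u) nu = 0.
  apply: etrans (dot_suml _ _ _ _) _; apply: big1 => k _.
  by apply: etrans (dotZl _ _ _) _; rewrite dotC H mulr0.
by apply: etrans (congr1 (fun y => _ - y) z) _; rewrite subr0.
Qed.

(** Both sides are normal, and they have the same inner product with every
    normal vector; so their difference is orthogonal to itself. *)
Lemma coord_sff_transition u i j : O u ->
  coord_sff f i j u = \sum_a \sum_b (jac u i a * jac u j b) *:
    coord_sff f' a b (t u).
Proof.
move=> Ou; apply/eqP; rewrite -subr_eq0; apply/eqP.
set S := \sum_a _; set W := coord_sff f i j u - S.
have SN l : dot S (d' l (t u)) = 0.
  apply: etrans (dot_suml _ _ _ _) _; apply: big1 => a _.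
  apply: etrans (dot_suml _ _ _ _) _; apply: big1 => b _.
  apply: etrans (dotZl _ _ _) _.
  by rewrite (coord_sff_normal U'open sf' inj' _ _ _ (tU Ou)) mulr0.
have hN l : dot (coord_sff f i j u) (d' l (t u)) = 0.
  rewrite (derive_old _ Ou); apply: (normal_dir sf _ (OU Ou)) => k.
  exact: (coord_sff_normal Uopen sf inj _ _ _ (OU Ou)).
have WN l : dot W (d' l (t u)) = 0.
  by apply: etrans (dotBl _ _ _) _; rewrite hN SN subr0.
have WNf k : dot W (d k u) = 0.
  rewrite (derive_transition _ Ou); exact: (normal_dir sf' _ (tU Ou)).
apply: dot_eq0; rewrite {1}/W; apply: etrans (dotBl _ _ _) _.
apply/eqP; rewrite subr_eq0; apply/eqP.
apply: etrans (coord_sff_dot _ _ WNf) _.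
apply: etrans (second_derive_transition _ _ Ou WN) _.
apply: esym; apply: etrans (dot_suml _ _ _ _) _; apply: eq_bigr => a _.
apply: etrans (dot_suml _ _ _ _) _; apply: eq_bigr => b _.
apply: etrans (dotZl _ _ _) _; apply: (congr1 ( *%R _)).
exact: coord_sff_dot.
Qed.

Lemma coord_mean_transition u : O u -> coord_mean f u = coord_mean f' (t u).
Proof.
move=> Ou; apply: (congr1 ( *:%R _)).
rewrite (metric_inv_transition Ou).
by apply: trace_congruence => i j; exact: coord_sff_transition.
Qed.

End invariance.

(** * The mean curvature as a global function, and its vanishing *)

(** Heine-Borel holds for the sup norm, which is bounded by the Euclidean one.
*)
Lemma compact_euclid_ball (R : realType) N (r : R) :
  compact [set v : 'rV[R]_N | dot v v <= r].
Proof.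
have dot_cont : continuous (fun v : 'rV[R]_N => dot v v).
  move=> v; rewrite /dot.
  have -> : (fun v : 'rV[R]_N => \sum_(i < N) v 0 i * v 0 i)
      = \sum_(i < N) (fun v : 'rV[R]_N => v 0 i * v 0 i).
    by apply/funext => w; rewrite fct_sumE.
  elim/big_ind : _ => [|F G cF cG|j _].
  - exact: cst_continuous.
  - exact: continuousD.
  - by apply: continuousM; exact: coord_continuous.
apply: bounded_closed_compact.
  have [r0|r0] := leP 0 r; last first.
    exists 0; split=> // M _ v /= vr.
    by have := lt_le_trans r0 (le_trans (dot_ge0 v) vr); rewrite ltxx.
  exists (r + 1); split; first exact: num_real.
  move=> M rM v /= vr; have M1 : 0 <=
    M by rewrite (le_trans _ (ltW rM))// addr_ge0.
  rewrite /Num.Def.normr/= mx_normrE (bigmax_le _ M1)// => -[i j] _ /=.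
  rewrite ord1; apply: le_trans (ltW rM).
  rewrite -ler_sqr ?nnegrE ?addr_ge0//.
  apply: (@le_trans _ _ r); last by rewrite sqrrD1; nra.
  apply: le_trans vr; rewrite real_normK ?num_real// expr2 /dot (bigD1 j)//=
    lerDl.
  by apply: sumr_ge0 => k _; rewrite -expr2 sqr_ge0.
have -> : [set v : 'rV[R]_N | dot v v <= r] =
  (fun v => dot v v) @^-1` [set y | y <= r].
  by [].
apply: closed_comp; last exact: closed_le.
by move=> v _; exact: dot_cont.
Qed.

Section global.
Variables (R : realType) (n N : nat) (M : smooth_manifold R n) (x : M ->
  'rV[R]_N).
Hypothesis imm : immersion x.
Hypothesis n0 : (0 < n)%N.
Implicit Types (c d : chart R n M) (p q : M).

Local Notation loc c := (x \o chart_inv c).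

Lemma loc_smooth c : atlas c -> smooth_on (chart_img c) (loc c).
Proof. by move=> /imm[]. Qed.

Lemma loc_inj c : atlas c -> forall u, chart_img c u ->
  forall v, 'D_v (loc c) u = 0 -> v = 0.
Proof. by move=> /imm[]. Qed.

Definition overlap c d : set 'rV[R]_n :=
  [set u | chart_img c u /\ chart_dom d (chart_inv c u)].

Lemma overlap_open c d : open (overlap c d).
Proof.
rewrite openE => u [cu du].
have n1 : nbhs u (chart_img c).
  by apply: open_nbhs_nbhs; split=> //; exact: chart_img_open.
have n2 : nbhs u (chart_inv c @^-1` chart_dom d).
  apply: (chart_inv_cont cu); apply: open_nbhs_nbhs; split=> //.
  exact: chart_dom_open.
exact: filterI n1 n2.
Qed.

Lemma coord_mean_chart c d p : atlas c -> atlas d -> chart_dom c p ->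
  chart_dom d p ->
  coord_mean (loc c) (chart_map c p) = coord_mean (loc d) (chart_map d p).
Proof.
move=> ac ad cp dp.
have ft u : overlap c d u -> loc d ((chart_map d \o chart_inv c) u) = loc c u.
  by move=> [cu du] /=; rewrite chart_mapK.
have OU : overlap c d `<=` chart_img c by move=> u [].
have tU u : overlap c d u -> chart_img d ((chart_map d \o chart_inv c) u).
  by move=> [cu du]; exact: chart_map_img.
have Op : overlap c d (chart_map c p).
  by split; [exact: chart_map_img|rewrite chart_mapK].
rewrite (coord_mean_transition (@chart_img_open _ _ _ c)
  (@chart_img_open _ _ _ d)
  (@overlap_open c d) (loc_smooth ac) (loc_smooth ad) (atlas_compatible ac ad)
  (loc_inj ac) (loc_inj ad) OU tU ft Op).
by rewrite /= chart_mapK.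
Qed.

Definition chart_at p : chart R n M := sval (cid2 (atlas_cover p)).

Lemma chart_atP p : atlas (chart_at p) /\ chart_dom (chart_at p) p.
Proof. by rewrite /chart_at; case: (cid2 _). Qed.

(** Read in an arbitrary chart at [p]; [mean_sqrE] shows that the choice does
    not matter. *)
Definition mean_sqr p : R :=
  let H := coord_mean (loc (chart_at p)) (chart_map (chart_at p) p) in dot H H.

Lemma mean_sqrE c p : atlas c -> chart_dom c p ->
  mean_sqr p = dot (coord_mean (loc c) (chart_map c p))
    (coord_mean (loc c) (chart_map c p)).
Proof.
move=> ac cp; have [aq dq] := chart_atP p.
by rewrite /mean_sqr (coord_mean_chart aq ac dq cp).
Qed.

Lemma mean_sqr_loc c u : atlas c -> chart_img c u ->
  mean_sqr (chart_inv c u) = dot (coord_mean (loc c) u) (coord_mean (loc c) u).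
Proof.
by move=> ac cu; rewrite (mean_sqrE ac) ?chart_invK//; exact: chart_inv_dom.
Qed.

Lemma chart_continuous (F : M -> R) :
  (forall c, atlas c -> scalar_smooth (chart_img c) (F \o chart_inv c)) ->
    continuous F.
Proof.
move=> sF p; have [ac cp] := chart_atP p; set c := chart_at p in ac cp.
have e : \forall q \near p, ((F \o chart_inv c) \o chart_map c) q = F q.
  have : nbhs p (chart_dom c).
    by apply: open_nbhs_nbhs; split=> //; exact: chart_dom_open.
  by apply: filterS => q cq /=; rewrite chart_mapK.
have Fc : {for p, continuous ((F \o chart_inv c) \o chart_map c)}.
  apply: continuous_comp; first exact: chart_map_cont.
  exact: scalar_smooth_cont (sF c ac) (chart_map_img cp).
move=> A; rewrite /= -{1}(nbhs_singleton e) => nA.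
apply: filterS2 _ e (Fc _ nA) => q /= <-; exact.
Qed.

(** The factor [r - |x|^2] vanishes on the boundary of the compact set where the
    maximum is taken, so that a nonzero maximum lies in the interior. *)
Definition test_fun r p : R := (r - dot (x p) (x p)) ^+ 2 * mean_sqr p.

Lemma test_fun_loc r c u : atlas c -> chart_img c u ->
  test_fun r (chart_inv c u) =
  (r - dot (loc c u) (loc c u)) ^+ 2 * dot (coord_mean (loc c) u)
    (coord_mean (loc c) u).
Proof. by move=> ac cu; rewrite /test_fun (mean_sqr_loc ac cu). Qed.

Lemma test_fun_continuous r : continuous (test_fun r).
Proof.
apply: chart_continuous => c ac.
have sf := loc_smooth ac; have o := @chart_img_open _ _ _ c.
have sp := dist_gap_smooth o sf r.
have sH := coord_mean_smooth o sf (loc_inj ac).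
apply: (scalar_smooth_ext o) (scalar_smooth_mul o (scalar_smooth_mul o sp sp)
  (scalar_smooth_dot o sH sH)) => u cu.
by rewrite [RHS](test_fun_loc _ ac cu) expr2.
Qed.

Lemma chart_frame c : atlas c ->
  exists e, orthonormal_frame (loc c) (chart_img c) e.
Proof.
move=> ac; have sf := loc_smooth ac; have o := @chart_img_open _ _ _ c.
have [e se He] := smooth_frame_exists o sf (loc_inj ac).
exists (fun i u => row i (e u)); split=> [i|u Uu i j].
  apply/(smooth_onP o) => j; apply: (scalar_smooth_ext o) (se i j) => u _.
  by rewrite mxE.
rewrite /push -(metric_dot sf _ _ Uu) -row_mul.
have := congr1 (fun A : 'M[R]_n => A i j) (He u Uu); rewrite !mxE => <-.
by apply: eq_bigr => k _; rewrite !mxE.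
Qed.

Variable lambda : R.
Hypothesis l0 : 0 <= lambda.
Hypothesis bim : biminimal x lambda.

(** Transport the maximum to a chart with an orthonormal frame, and apply
    [max_estimate]. *)
Lemma test_fun_local_max r p : dot (x p) (x p) < r ->
  (forall q, dot (x q) (x q) <= r -> test_fun r q <= test_fun r p) ->
  test_fun r p <= 28 * r.
Proof.
move=> pr mx; have [ac cp] := chart_atP p; set c := chart_at p in ac cp.
have sf := loc_smooth ac; have o := @chart_img_open _ _ _ c.
have [e fe] := chart_frame ac.
pose u := chart_map c p; have cu : chart_img c u := chart_map_img cp.
have pu : p = chart_inv c u by rewrite chart_mapK.
have frame_mean_curvatureE w : chart_img c w -> mean_curvature (loc c) e w =
  coord_mean (loc c) w.
  by move=> cw; exact: (mean_curvatureE o sf (loc_inj ac) o (@subset_refl _ _)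
    cw fe).
have tE w : chart_img c w -> test_fun r (chart_inv c w) =
    (r - dot (loc c w) (loc c w)) ^+ 2 *
    dot (mean_curvature (loc c) e w) (mean_curvature (loc c) e w).
  by move=> cw; rewrite (test_fun_loc _ ac cw) (frame_mean_curvatureE _ cw).
have p0 : 0 < r - dot (loc c u) (loc c u) by rewrite subr_gt0 /= -pu.
rewrite pu (tE _ cu).
apply: (max_estimate o sf (loc_inj ac) n0 fe l0 _ cu p0).
  move=> w cw; exact: (bim ac o (@subset_refl _ _) fe cw).
have n1 : nbhs u (chart_img c) by apply: open_nbhs_nbhs.
have n2 : \forall w \near u, 0 < r - dot (loc c w) (loc c w).
  have := scalar_smooth_cont (dist_gap_smooth o sf r) cu;
    rewrite /prop_for /continuous_at.
  by move/cvgr_gt => /(_ _ p0).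
apply: filterS2 _ n1 n2 => w cw pw.
rewrite -(tE _ cw) -(tE _ cu) -pu; apply: mx.
by rewrite -subr_ge0; exact: ltW pw.
Qed.

Hypothesis prop : proper_map x.

Lemma test_fun_bound r p : dot (x p) (x p) <= r -> test_fun r p <= 28 * r.
Proof.
move=> pr; have cK := prop (@compact_euclid_ball R N r).
have r0 : 0 <= r by exact: le_trans (dot_ge0 _) pr.
have [||q qK mx] := @compact_EVT_max M R (test_fun r) _ _ cK.
- by exists p.
- exact/continuous_subspaceT/test_fun_continuous.
have qr : dot (x q) (x q) <= r by move: qK; rewrite inE.
apply: le_trans (mx p _) _; first by rewrite inE.
move: qr; rewrite le_eqVlt => /predU1P[qr|qr].
  by rewrite /test_fun qr subrr expr0n mul0r mulr_ge0.
by apply: (test_fun_local_max qr) => q' q'r; apply: mx; rewrite inE.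
Qed.

(** If [|H|^2 <= 28 r / (r - |x|^2)^2] for all large [r], then [|H|^2] is
    arbitrarily small. *)
Lemma mean_sqr_eq0 p : mean_sqr p = 0.
Proof.
have s0 : 0 <= mean_sqr p by exact: dot_ge0.
apply/eqP; rewrite eq_le s0 andbT; apply/ler_addgt0Pr => eps e0; rewrite add0r.
pose a := dot (x p) (x p); have a0 : 0 <= a := dot_ge0 _.
(* For [r >= 2 a] the bound [28 r / (r - a)^2] is at most [112 / r]. *)
pose r := 2 * a + 112 / eps.
have q0 : 0 < 112 / eps by rewrite divr_gt0.
have ar : a <= r by rewrite /r; lra.
have := @test_fun_bound r p ar; rewrite /test_fun -/a.
have r0 : 0 < r by rewrite /r; lra.
have h : r / 2 <= r - a by rewrite /r; lra.
have h2 : (r / 2) ^+ 2 <= (r - a) ^+ 2 by rewrite ler_sqr// nnegrE; lra.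
move=> h3; have h4 : (r / 2) ^+ 2 * mean_sqr p <= 28 * r.
  by apply: le_trans h3; exact: ler_wpM2r.
have h5 : r * (r * mean_sqr p) <= r * 112 by move: h4; rewrite expr2; lra.
rewrite (ler_pM2l r0) in h5.
rewrite -(ler_pM2l r0); apply: le_trans h5 _.
have -> : 112 = (112 / eps) * eps :> R by rewrite divfK// gt_eqF.
by rewrite ler_pM2r// /r; lra.
Qed.

End global.

Theorem theorem3p2 (R : realType) (n N : nat) (M : smooth_manifold R n)
    (x : M -> 'rV[R]_N) :
  immersion x ->
  proper_map x ->
  nonnegative_biminimal x ->
  minimal x.
Proof.
move=> imm prop [lambda [l0 bim]] c ac V Vo VU e fe u Vu.
have [n0|n0] := posnP n.
  have inv0 : n%:R^-1 = 0 :> R by rewrite n0 invr0.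
  by rewrite /mean_curvature inv0 scale0r.
have cu := VU u Vu.
rewrite (mean_curvatureE (@chart_img_open _ _ _ c) (loc_smooth imm ac)
  (loc_inj imm ac) Vo VU Vu fe).
apply: dot_eq0; rewrite -(mean_sqr_loc imm ac cu).
exact: mean_sqr_eq0 imm n0 _ l0 bim prop _.
Qed.
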